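(* Let $(u_n,\mu_n)$ be a sequence in $\mathcal{D}$ that converges to $(u,\mu)\in\mathcal{D}$ in $\mathcal{D}$, i.e. $d_{\mathcal{D}}((u_n,\mu_n),(u,\mu))\to0$. Then $$u_n\to u\ \text{ in } L^\infty_{\rm per}\qquad\text{and}\qquad \mu_n\overset{\ast}{\rightharpoonup}\mu.$$
   Context: **Function spaces.** ''Periodic'' means 1-periodic on $\mathbb{R}$. $L^\infty_{\rm per}$ is the space of periodic $L^\infty$ functions. $\mu_n\overset{\ast}{\rightharpoonup}\mu$ denotes weak-$*$ convergence of Radon measures: $\int\phi\,d\mu_n\to\int\phi\,d\mu$ for all $\phi\in C_c(\mathbb{R})$. $V_1=\{f\in W^{1,1}_{\rm loc}(\mathbb{R}): f(\xi+1)=f(\xi)+1\ \forall\xi\}$; $V=\{f\in W^{1,1}_{\rm loc}(\mathbb{R}):\exists\alpha\in\mathbb{R},\ f(\xi+1)=f(\xi)+\alpha\ \forall\xi\}$ with norm $\|f\|_V=\|f\|_{L^\infty([0,1])}+\|f_\xi\|_{L^1([0,1])}$; $W^{1,1}_{\rm per}$ is the space of periodic functions in $W^{1,1}_{\rm loc}(\mathbb{R})$ with the same norm; $L^1_{\rm per}$ is the space of periodic $L^1_{\rm loc}$ functions with norm $\|\cdot\|_{L^1([0,1])}$; $W^{1,\infty}_{\rm per}$ is the space of periodic functions in $W^{1,\infty}_{\rm loc}(\mathbb{R})$. $E=V\times W^{1,1}_{\rm per}\times L^1_{\rm per}$ with the sum norm. **Lagrangian set.** $\mathcal{F}$ is the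 set of $X=(y,U,\nu)\in E$ with $y\in V_1$; $y,U\in W^{1,\infty}_{\rm loc}(\mathbb{R})$; $\nu\in L^\infty$; $y_\xi\ge0$, $\nu\ge0$ and $y_\xi+\nu\ge c$ a.e. for some constant $c>0$; $y_\xi\nu=y_\xi^2U^2+U_\xi^2$ a.e. For $X\in\mathcal{F}$ write $h=\|\nu\|_{L^1([0,1])}$. **Relabeling.** $G$ is the group (under composition) of invertible $f\colon\mathbb{R}\to\mathbb{R}$ with $f\in W^{1,\infty}_{\rm loc}(\mathbb{R})$, $f(\xi+1)=f(\xi)+1$ for all $\xi$, and $f-\mathrm{id},f^{-1}-\mathrm{id}\in W^{1,\infty}_{\rm per}$. For $X=(y,U,\nu)\in\mathcal{F}$, $f\in G$: $X\bullet f=(y\circ f,U\circ f,(\nu\circ f)f_\xi)\in\mathcal{F}$. $\mathcal{F}_0=\{X\in\mathcal{F}: y_\xi+\nu=1+h \text{ a.e.}\}$ and $\mathcal{H}=\{(y,U,\nu)\in\mathcal{F}_0:\int_0^1y\,d\xi=0\}$. $\Pi_1\colon\mathcal{F}\to\mathcal{F}_0$, $\Pi_1(X)=X\bullet f^{-1}$ with $f(\xi)=\frac1{1+h}\big(y(\xi)+\int_0^\xi\nu\,d\eta\big)$; $\Pi_2\colon\mathcal{F}_0\to\mathcal{H}$, $\Pi_2(X)=X(\cdot-a)$ with $a=\int_0^1y\,d\xi$; $\Pi=\Pi_2\circ\Pi_1\colon\mathcal{F}\to\mathcal{H}$. **Lagrangian metric.** $J(X,Y)=\inf_{f,g\in G}\|X\bullet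 f-Y\bullet g\|_E$ for $X,Y\in\mathcal{F}$; $d(X,Y)=\inf\sum_{n=1}^NJ(X_{n-1},X_n)$ over all finite sequences $\{X_n\}_{n=0}^N$ in $\mathcal{F}$ with $X_0=X$, $X_N=Y$. **Eulerian set and metric.** $\mathcal{D}$ is the set of pairs $(u,\mu)$ with $u\in H^1_{\rm per}$ (period 1) and $\mu$ a positive 1-periodic Radon measure on $\mathbb{R}$ whose absolutely continuous part is $\mu_{\rm ac}=(u^2+u_x^2)\,dx$. $L\colon\mathcal{D}\to\mathcal{H}$: given $(u,\mu)$, set $h=\mu([0,1))$, $F_\mu(x)=\mu([0,x))$ if $x>0$, $F_\mu(0)=0$, $F_\mu(x)=-\mu([x,0))$ if $x<0$, $y(\xi)=\sup\{y: F_\mu(y)+y<(1+h)\xi\}$, $\nu=(1+h)-y_\xi$, $U=u\circ y$; then $(y,U,\nu)\in\mathcal{F}_0$ and $L(u,\mu)=\Pi(y,U,\nu)$. $d_{\mathcal{D}}((u,\mu),(\tilde u,\tilde\mu))=d(L(u,\mu),L(\tilde u,\tilde\mu))$. *)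

(* Defs.v *)
From HB Require Import structures.
From mathcomp Require Import all_boot all_order all_algebra.
From mathcomp Require Import all_classical all_reals all_analysis.
Set Implicit Arguments.
Unset Strict Implicit.
Unset Printing Implicit Defensive.
Import Order.TTheory GRing.Theory Num.Theory.
Import numFieldNormedType.Exports.
Local Open Scope classical_set_scope.
Local Open Scope ring_scope.

Section Sobolev.
Context {R : realType}.
Notation leb := (@lebesgue_measure R).
Implicit Types f g phi : R -> R.

Definition compactly_supported phi := compact (closure [set x | phi x != 0]).

Definition C1c phi :=
  [/\ forall x, derivable phi x 1, continuous (derive1 phi) &
      compactly_supported phi].

(* Testing against C^1 or against C^oo functions of compact support gives the
   same notion. *)
Definition weak_derivative f g :=
  locally_integrable [set: R] g /\
  forall phi, C1c phi ->
    \int[leb]_x (f x * derive1 phi x) = - \int[leb]_x (g x * phi x).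

(* A Borel representative of the weak derivative; it is determined up to a
   null set, and is the junk value 0 if there is no weak derivative. *)
Definition wderiv f : R -> R := xget (cst 0) [set g | weak_derivative f g].

(* Sobolev functions are represented by their continuous representatives, since
   they are evaluated pointwise and composed; functions that are only L^1 or
   L^oo are represented by Borel functions considered up to null sets. *)
Definition W11loc f := continuous f /\ exists g, weak_derivative f g.

Definition W1oo_loc f :=
  W11loc f /\ forall M : R, exists C : R,
    \forall x \ae leb, `|x| <= M -> `|wderiv f x| <= C.

Definition V1 f := W11loc f /\ forall x, f (x + 1) = f x + 1.

Definition V f := W11loc f /\ exists alpha : R, forall x, f (x + 1) = f x + alpha.

Definition W11per f := W11loc f /\ periodic f 1.

Definition W1oo_per f := W1oo_loc f /\ periodic f 1.

(* Periodicity of an L^1 class only makes sense almost everywhere; in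
   particular [wderiv f] is only a.e. periodic when [f] is periodic. *)
Definition L1per f :=
  locally_integrable [set: R] f /\ \forall x \ae leb, f (x + 1) = f x.

Definition H1per f :=
  [/\ W11loc f, periodic f 1,
      (\int[leb]_(x in `[0%R, 1%R]) ((f x) ^+ 2)%:E < +oo)%E &
      (\int[leb]_(x in `[0%R, 1%R]) ((wderiv f x) ^+ 2)%:E < +oo)%E].

Definition normL1 f : \bar R := (\int[leb]_(x in `[0%R, 1%R]) `|f x|%:E)%E.

Definition normLoo f : \bar R :=
  ('N[leb]_+oo [EFin \o (f \_ `[0%R, 1%R])])%E.

Definition normV f : \bar R := (normLoo f + normL1 (wderiv f))%E.

Definition oriented_integral f (a b : R) : R :=
  if a <= b then \int[leb]_(x in `[a, b]) f x
  else - \int[leb]_(x in `[b, a]) f x.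

End Sobolev.

Section Lagrangian.
Context {R : realType}.
Notation leb := (@lebesgue_measure R).

Record lagr := Lagr { ly : R -> R ; lU : R -> R ; lnu : R -> R }.
Implicit Types X Y : lagr.

Definition lagr_sub X Y : lagr :=
  Lagr (ly X \- ly Y) (lU X \- lU Y) (lnu X \- lnu Y).

Definition inE_space X := [/\ V (ly X), W11per (lU X) & L1per (lnu X)].

Definition normE X : \bar R := (normV (ly X) + normV (lU X) + normL1 (lnu X))%E.

Definition inF X :=
  [/\ inE_space X, V1 (ly X), W1oo_loc (ly X) & W1oo_loc (lU X)] /\
  [/\ exists C : R, \forall x \ae leb, `|lnu X x| <= C,
      \forall x \ae leb, 0 <= wderiv (ly X) x,
      \forall x \ae leb, 0 <= lnu X x,
      exists2 c : R, 0 < c & \forall x \ae leb, c <= wderiv (ly X) x + lnu X x &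
      \forall x \ae leb, wderiv (ly X) x * lnu X x =
        (wderiv (ly X) x) ^+ 2 * (lU X x) ^+ 2 + (wderiv (lU X) x) ^+ 2].

Definition lh X : R := fine (normL1 (lnu X)).

Definition inverse_fun (f : R -> R) : R -> R := 'pinv_(cst 0) [set: R] f.

Definition inG (f : R -> R) :=
  [/\ bijective f, W1oo_loc f, forall x, f (x + 1) = f x + 1,
      W1oo_per (f \- id) & W1oo_per (inverse_fun f \- id)].

Definition relabel X (f : R -> R) : lagr :=
  Lagr (ly X \o f) (lU X \o f) (fun x => lnu X (f x) * wderiv f x).

Definition Pi1 X : lagr :=
  relabel X (inverse_fun (fun xi =>
    (1 + lh X)^-1 * (ly X xi + oriented_integral (lnu X) 0 xi))).

Definition Pi2 X : lagr :=
  let a := \int[leb]_(x in `[0, 1]) ly X x in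
  Lagr (fun x => ly X (x - a)) (fun x => lU X (x - a)) (fun x => lnu X (x - a)).

Definition Pi X : lagr := Pi2 (Pi1 X).

Definition J X Y : \bar R :=
  ereal_inf [set r | exists f g, [/\ inG f, inG g &
    r = normE (lagr_sub (relabel X f) (relabel Y g))]].

(* There is always a chain between two elements of F; [d] is +oo if [X] or [Y]
   is not in F. *)
Definition d X Y : \bar R :=
  ereal_inf [set r | exists (N : nat) (Z : nat -> lagr),
    [/\ forall n, (n <= N)%N -> inF (Z n), Z 0%N = X, Z N = Y &
        r = (\sum_(1 <= n < N.+1) J (Z n.-1) (Z n))%E]].

End Lagrangian.
Arguments lagr : clear implicits.

Section Eulerian.
Context {R : realType}.
Notation leb := (@lebesgue_measure R).
Notation borel_measure := {measure set (measurableTypeR R) -> \bar R}.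
Implicit Types (u : R -> R) (mu : borel_measure).

(* On the real line a Borel measure that is finite on compact sets is
   automatically regular. *)
Definition radon mu := forall K : set R, compact K -> (mu K < +oo)%E.

Definition periodic_measure mu :=
  forall A : set R, measurable A -> mu [set x + 1 | x in A] = mu A.

Definition singular_measure mu :=
  exists2 N : set R, measurable N & leb N = 0%E /\ mu (~` N) = 0%E.

(* [mu = w dx + mus] with [mus] singular is the Lebesgue decomposition of [mu],
   so that its absolutely continuous part is [w dx]. *)
Definition ac_part_density mu (w : R -> R) :=
  exists mus : borel_measure, singular_measure mus /\
    forall A : set R, measurable A ->
      mu A = (\int[leb]_(x in A) (w x)%:E + mus A)%E.

Definition inD u mu :=
  [/\ H1per u, radon mu, periodic_measure mu &
      ac_part_density mu (fun x => (u x) ^+ 2 + (wderiv u x) ^+ 2)].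

Definition Fmu mu (x : R) : R :=
  if 0 <= x then fine (mu [set` `[0, x[]) else - fine (mu [set` `[x, 0[]).

Definition Lmap u mu : lagr R :=
  let h := fine (mu [set` `[0, 1[]) in
  let y xi := sup [set z : R | Fmu mu z + z < (1 + h) * xi] in
  Pi (Lagr y (u \o y) (fun xi => (1 + h) - wderiv y xi)).

Definition dD u mu u' mu' : \bar R := d (Lmap u mu) (Lmap u' mu').

Definition weak_star_cvg (mu_ : nat -> borel_measure) mu :=
  forall phi : R -> R, continuous phi -> compactly_supported phi ->
    (\int[mu_ n]_x (phi x)%:E)%E @[n --> \oo] --> (\int[mu]_x (phi x)%:E)%E.

End Eulerian.

(* Main.v *)
(** Idea. Follow a chain X_0, ..., X_N of elements of F label by label: if
    X o f and Y o g are close, then k = f o g^-1 carries the labels of Y to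
    those of X, and X o k is close to Y.  Sup norms are invariant under
    composition, and the total variation of the energy nu dxi is invariant under
    relabeling by the change of variables formula for f and g, so along the
    chain the errors simply add up and d(X, Y) < delta yields a single k.

    For the end points, U = u o y, so the uniform continuity of the limit u gives
    u_n -> u uniformly.  Moreover mu is the image of nu dxi under y: y is the
    generalized inverse of G(x) = x + F_mu(x), hence the preimage of [a, b[ is
    [G(a), G(b)[ / (1 + h), on which nu = (1 + h) - y_xi has integral
    G(b) - G(a) - (b - a) = mu([a, b[).  Therefore the integral of a test function
    phi against mu is the integral over one period of (Phi o y) nu, with Phi the
    periodization of phi, and Phi is bounded and uniformly continuous.

    Weak derivatives are handled through primitives: testing against C^1 step
    functions shows that they integrate to increments, and conversely a monotone
    Lipschitz function has a density by Radon-Nikodym. *)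

Require Import Defs.
From HB Require Import structures.
From mathcomp Require Import all_boot all_order all_algebra.
From mathcomp Require Import all_classical all_reals all_analysis.
From mathcomp Require Import measurable_realfun ess_sup_inf ring lra.
Import Order.TTheory GRing.Theory Num.Theory.
Import numFieldNormedType.Exports.
Local Open Scope classical_set_scope.
Local Open Scope ring_scope.
Set Implicit Arguments.
Unset Strict Implicit.
Unset Printing Implicit Defensive.

(** * Densities and transport of measures *)

Section measure_with_density.
Local Open Scope ereal_scope.
Context d (T : measurableType d) (R : realType) (mu : {measure set T -> \bar R}).
Variable g : T -> R.
Hypotheses (mg : measurable_fun [set: T] g) (g0 : forall x, (0 <= g x)%R).

(** The two proofs are arguments so that the measure structure declared below can be inferred from
    the term alone. *)
Definition density of measurable_fun [set: T] g & (forall x, (0 <= g x)%R) :=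
  fun A : set T => \int[mu]_(x in A) (g x)%:E.

Local Notation nu := (density mg g0).

Let nu0 : nu set0 = 0. Proof. exact: integral_set0. Qed.

Let nu_ge0 A : 0 <= nu A.
Proof. by apply: integral_ge0 => x _; rewrite lee_fin. Qed.

Let nu_sigma_additive : semi_sigma_additive nu.
Proof.
apply: semi_sigma_additive_nng_induced; first exact/measurable_EFinP.
by move=> x; rewrite lee_fin.
Qed.

HB.instance Definition _ :=
  isMeasure.Build _ _ _ nu nu0 nu_ge0 nu_sigma_additive.

Import HBNNSimple.

(** Both sides are monotone limits along simple functions increasing to [f], so only simple
    functions have to be compared. *)
Lemma ge0_integral_density (f : T -> \bar R) :
  measurable_fun [set: T] f -> (forall x, 0 <= f x) ->
  \int[nu]_x f x = \int[mu]_x (f x * (g x)%:E).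
Proof.
move=> mf f0; pose h := nnsfun_approx measurableT mf.
have hf x : (h n x)%:E @[n --> \oo] --> f x by exact: cvg_nnsfun_approx.
have ndh x m n : (m <= n)%N -> (h m x <= h n x)%R.
  by move=> mn; exact/lefP/nd_nnsfun_approx.
have mh n : measurable_fun [set: T] (h n) by exact: measurable_funP.
have -> : \int[nu]_x f x = limn (fun n => \int[nu]_x (h n x)%:E).
  under eq_integral do rewrite -(cvg_lim _ (hf _))//.
  apply: monotone_convergence => //.
  - by move=> n; exact/measurable_EFinP.
  - by move=> n x _; rewrite lee_fin.
  - by move=> x _ m n mn; rewrite lee_fin ndh.
have -> : \int[mu]_x (f x * (g x)%:E) =
    limn (fun n => \int[mu]_x ((h n x)%:E * (g x)%:E)).
  have hfg x : (h n x)%:E * (g x)%:E @[n --> \oo] --> f x * (g x)%:E.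
    exact: cvgeZr.
  under eq_integral do rewrite -(cvg_lim _ (hfg _))//.
  apply: monotone_convergence => //.
  - by move=> n; apply/measurable_EFinP/measurable_funM.
  - by move=> n x _; rewrite lee_fin mulr_ge0.
  - by move=> x _ m n mn; rewrite lee_fin ler_wpM2r// ndh.
(* The simple function [h n] is split over its finite range; on each level set the claim is the
   definition of [density]. *)
congr (limn _); apply/funext => n.
transitivity (\sum_(y \in range (h n))
    \int[nu]_x (y * \1_(h n @^-1` [set y]) x)%:E).
  rewrite -ge0_integral_fsum//.
  - by apply: eq_integral => x _; rewrite fimfunE -fsumEFin.
  - by move=> y; apply/measurable_EFinP/measurable_funM.
  - by move=> y x _; exact: nnfun_muleindic_ge0.
transitivity (\sum_(y \in range (h n))
    \int[mu]_x ((y * \1_(h n @^-1` [set y]) x)%:E * (g x)%:E)); last first.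
  rewrite -ge0_integral_fsum//.
  - apply: eq_integral => x _; rewrite [in RHS]fimfunE -fsumEFin//.
    by rewrite ge0_mule_fsuml// => y; exact: nnfun_muleindic_ge0.
  - move=> y; apply/measurable_EFinP/measurable_funM => //.
    exact: measurable_funM.
  - by move=> y x _; rewrite mule_ge0 ?nnfun_muleindic_ge0 ?lee_fin.
apply: eq_fsbigr => y /[!inE] -[x _ <-].
under [LHS]eq_integral do rewrite EFinM.
rewrite [RHS](_ : _ = \int[mu]_z ((h n x)%:E *
    ((\1_(h n @^-1` [set h n x]) z)%:E * (g z)%:E))); last first.
  by apply: eq_integral => z _; rewrite EFinM muleA.
rewrite !ge0_integralZl//.
- rewrite integral_indic// setIT; congr (_ * _).
  rewrite /= /density integral_mkcond; apply: eq_integral => z _.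
  by rewrite epatch_indic muleC.
- by apply/measurable_EFinP/measurable_funM.
- by move=> z _; rewrite mule_ge0 ?lee_fin.
- by rewrite lee_fin.
- exact/measurable_EFinP.
- by rewrite lee_fin.
Qed.

End measure_with_density.

Section lebesgue_transfer.
Context {R : realType}.
Notation leb := (@lebesgue_measure R).
Notation borel_measure := {measure set (measurableTypeR R) -> \bar R}.
Local Open Scope ereal_scope.

(** Half-open intervals form a generating family stable under intersection, and the [[-k, k[]
    exhaust the line with finite mass. The closed end is on the left to match the definition of
    [Fmu]. *)
Lemma measure_unique_itvco (m1 m2 : borel_measure) :
  (forall a b : R, (a < b)%R -> m1 `[a, b[%classic = m2 `[a, b[%classic) ->
  (forall a b : R, m1 `[a, b[%classic < +oo) ->
  forall A : set (measurableTypeR R), measurable A -> m1 A = m2 A.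
Proof.
move=> m12 m1oo; pose G := [set A : set R | exists a b : R, A = `[a, b[%classic].
apply: (@measure_unique _ _ (measurableTypeR R) G
   (fun k => `[(- k%:R)%R, k%:R[%classic)).
- rewrite RGenCInfty.measurableE eqEsubset; split => A.
    apply: smallest_sub; first exact: smallest_sigma_algebra.
    move=> _ [a ->]; rewrite itvbndyEbigcup.
    apply: sigma_algebra_bigcup => k; apply: sub_sigma_algebra.
    by exists a, k%:R.
  apply: smallest_sub; first exact: smallest_sigma_algebra.
  by move=> _ [a [b ->]]; exact: RGenCInfty.measurable_itv_bounded.
- move=> _ _ [a [b ->]] [a' [b' ->]].
  exists (Num.max a a'), (Num.min b b').
  apply/predeqP => x /=; rewrite !in_itv/= ge_max lt_min; split.
    by move=> [/andP[-> ->] /andP[-> ->]].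
  by move=> /andP[/andP[-> ->] /andP[-> ->]].
- by move=> k; do 2 eexists.
- apply/seteqP; split=> // x _; exists (Num.truncn `|x|).+1 => //=; rewrite in_itv/=.
  have := truncnS_gt `|x|%R; rewrite ltr_norml => /andP[/ltW -> ->//].
- move=> _ [a [b ->]]; have [/m12//|ba] := ltP a b.
  by rewrite set_itv_ge ?measure0// bnd_simp -leNgt.
- by move=> k; exact: m1oo.
Qed.

(** The image of [g dx] under [phi] agrees with [m] on half-open intervals, hence everywhere.
    Translations, relabelings and the quantile map of an Eulerian measure are all handled by this
    statement. *)
Lemma transfer_itvco (m : borel_measure) (phi g : R -> R) :
  measurable_fun [set: R] phi -> measurable_fun [set: R] g ->
  (forall x, (0 <= g x)%R) ->
  (forall a b : R, m `[a, b[%classic < +oo) ->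
  (forall a b : R, (a < b)%R ->
    \int[leb]_(x in phi @^-1` `[a, b[%classic) (g x)%:E = m `[a, b[%classic) ->
  forall t : R -> \bar R, measurable_fun [set: R] t -> (forall x, 0 <= t x) ->
  \int[leb]_x (t (phi x) * (g x)%:E) = \int[m]_x t x.
Proof.
move=> mphi mg g0 moo phim t mt t0.
pose nu : borel_measure := density leb mg g0.
rewrite -(@ge0_integral_density _ _ _ leb _ mg g0 (t \o phi)); last 2 first.
- exact: (measurableT_comp mt mphi).
- by move=> x; exact: t0.
have <- := @ge0_integral_pushforward _ _ (measurableTypeR R) (measurableTypeR R)
  R phi mphi nu setT t measurableT mt (fun x _ => t0 x).
apply: eq_measure_integral => A mA _.
symmetry; apply: measure_unique_itvco => // a b ab.
by rewrite -phim.
Qed.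

End lebesgue_transfer.

(** * Locally integrable functions and C^1 step functions *)

Section locally_integrable_functions.
Context {R : realType}.
Notation leb := (@lebesgue_measure R).
Implicit Types f g : R -> R.

Lemma locally_integrable_itv f (a b : R) (ba bb : bool) :
  locally_integrable [set: R] f ->
  leb.-integrable [set` Interval (BSide ba a) (BSide bb b)] (EFin \o f).
Proof.
move=> [mf _ fK].
have fab : leb.-integrable `[a, b] (EFin \o f).
  apply/integrableP; split; first exact/measurable_EFinP/measurable_funTS.
  exact: (fK `[a, b]%classic (@subsetT _ _) (@segment_compact _ a b)).
apply: integrableS fab => //.
by apply: subset_itv; rewrite ?bnd_simp.
Qed.

(** Lebesgue differentiation: almost every [g x] is the limit of the averages of [g] over []x, x +
    1/(n+1)]], which are nonnegative. *)
Lemma ae_ge0_of_integral_ge0 g : locally_integrable [set: R] g ->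
  (forall a b : R, a < b -> 0 <= \int[leb]_(x in `]a, b]) g x) ->
  \forall x \ae leb, 0 <= g x.
Proof.
move=> lg g0; pose E (x : R) (n : nat) := `]x, x + n.+1%:R^-1]%classic.
have muE x n : leb (E x n) = (n.+1%:R^-1 : R)%:E.
  rewrite /E lebesgue_measure_itv/= lte_fin ltrDl invr_gt0 ltr0n/=.
  by rewrite -EFinB addrAC subrr add0r.
have niceE x : nicely_shrinking x (E x).
  split; first by move=> n; exact: measurable_itv.
  (* The ball of radius [2/(n+1)] contains the interval, and its measure is 4 times the length of
     the interval. *)
  exists (4, fun n => (2 * n.+1%:R^-1)%:pos); split => //=.
  - rewrite -[X in _ --> X](mulr0 2); apply: cvgM; first exact: cvg_cst.
    exact: cvg_harmonic.
  - move=> n y; rewrite /E/= in_itv/= /ball/= => /andP[xy yx].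
    have n0 : 0 < n.+1%:R^-1 :> R by rewrite invr_gt0.
    rewrite -[ltRHS]/(2 * n.+1%:R^-1) ltr_norml.
    by move: n.+1%:R^-1 n0 xy yx => r *; apply/andP; split; lra.
  - move=> n; rewrite lebesgue_measure_ball//.
    by rewrite [leb _]muE -EFinM lee_fin/=; move: (n.+1%:R^-1) => r; lra.
apply: (@filterS _ _ (ae_filter_ringOfSetsType leb) _ _ _
  (lebesgue_differentiation lg)) => x lx.
have := nice_lebesgue_differentiation niceE lg lx => /= xg.
rewrite -lee_fin -(cvg_lim _ xg)//; apply: lime_ge.
  by apply/cvg_ex; eexists; exact: xg.
apply: nearW => n; apply: mule_ge0; first by rewrite inve_ge0.
have := g0 x (x + n.+1%:R^-1); rewrite ltrDl invr_gt0 ltr0n => /(_ isT).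
rewrite /Rintegral -lee_fin fineK//.
by apply: integrable_fin_num => //; exact: locally_integrable_itv.
Qed.

End locally_integrable_functions.

Section test_functions.
Context {R : realType}.
Notation leb := (@lebesgue_measure R).
Implicit Types (f g : R -> R) (a e x : R).

(** A quadratic bound on the remainder treats [max(x - c, 0)^2] at every point at once, the kink [c]
    included. *)
Lemma is_derive_quadratic_error f x l (K : R) : 0 <= K ->
  (forall h, `|f (x + h) - f x - l * h| <= K * h ^+ 2) -> is_derive x 1 f l.
Proof.
move=> K0 fl.
have cv : (fun h : R => h^-1 *: ((f \o shift x) (h *: 1) - f x)) @ 0^' --> l.
  apply/cvgrPdist_le => e e0.
  have eK : 0 < e / (K + 1) by rewrite divr_gt0// ltr_wpDl.
  near=> h.
  have h0 : h != 0 by near: h; exact: nbhs_dnbhs_neq.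
  have he : `|h| <= e / (K + 1).
    near: h; apply: dnbhs0_le => //.
  rewrite -[_%:A]mulr1 /= mulr1 scaler1.
  have -> : l - h^-1 *: (f (h + x) - f x) = - h^-1 * (f (x + h) - f x - l * h).
    by rewrite addrC; rewrite /GRing.scale/= [h + x]addrC; field.
  rewrite normrM normrN normfV ler_pdivrMl ?normr_gt0//.
  apply: (le_trans (fl h)); rewrite -(real_normK (num_real h)) expr2 mulrA.
  rewrite mulrC ler_wpM2l//.
  rewrite (le_trans (ler_wpM2l K0 he))// mulrCA ger_pMr//.
  by rewrite ler_pdivrMr ?mul1r ?lerDl// ltr_wpDl.
apply: DeriveDef; first by apply/cvg_ex; exists l.
exact: cvg_lim cv.
Unshelve. all: by end_near. Qed.

(* Second differences of [max(x, 0)^2], which is C^1, and of its derivative. *)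
Definition step a e x :=
  (Num.max (x - a) 0 ^+ 2 - 2 * Num.max (x - (a + e)) 0 ^+ 2
   + Num.max (x - (a + 2 * e)) 0 ^+ 2) / (2 * e ^+ 2).

Definition tent a e x :=
  (Num.max (x - a) 0 - 2 * Num.max (x - (a + e)) 0
   + Num.max (x - (a + 2 * e)) 0) / e ^+ 2.

Lemma is_derive_step a e x : 0 < e -> is_derive x 1 (step a e) (tent a e x).
Proof.
move=> e0.
have sh c : is_derive x 1 (fun t => Num.max (t - c) 0 ^+ 2) (2 * Num.max (x - c) 0).
  apply: (@is_derive_quadratic_error _ _ _ 1) => // h; rewrite mul1r ler_norml.
  by rewrite /Num.max; case: ltP => ?; case: ltP => ?; apply/andP; split; nra.
have -> : tent a e x = (2 * e ^+ 2)^-1 *: (2 * Num.max (x - a) 0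
    - 2 *: (2 * Num.max (x - (a + e)) 0) + 2 * Num.max (x - (a + 2 * e)) 0).
  by rewrite /tent /GRing.scale/=; field; rewrite gt_eqF.
have -> : step a e = (2 * e ^+ 2)^-1 \*: ((fun t => Num.max (t - a) 0 ^+ 2)
    - 2 \*: (fun t => Num.max (t - (a + e)) 0 ^+ 2)
    + (fun t => Num.max (t - (a + 2 * e)) 0 ^+ 2)).
  by apply/funext => t; rewrite /step mulrC.
by apply: is_deriveZ.
Qed.

Lemma continuous_tent a e : continuous (tent a e).
Proof.
have c (b : R) : continuous (fun t : R => Num.max (t - b) 0).
  move=> t.
  apply: (@continuous_max R R (fun t => t - b) (cst 0)); last exact: cvg_cst.
  by apply: cvgB; [exact: cvg_id|exact: cvg_cst].
move=> t; apply: cvgMl; apply: cvgD; last exact: c.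
by apply: cvgB; [exact: c|apply: cvgMr; exact: c].
Qed.

Lemma tent_ge0 a e x : 0 < e -> 0 <= tent a e x.
Proof.
move=> e0; rewrite mulr_ge0 ?invr_ge0 ?sqr_ge0//.
by rewrite /Num.max; case: ltP => ?; case: ltP => ?; case: ltP => ?; lra.
Qed.

Lemma tent_out a e x : 0 < e -> x \notin `[a, a + 2 * e] -> tent a e x = 0.
Proof.
move=> e0; rewrite in_itv/= negb_and -!ltNge => ax; rewrite /tent.
suff -> : Num.max (x - a) 0 - 2 * Num.max (x - (a + e)) 0
   + Num.max (x - (a + 2 * e)) 0 = 0 by rewrite mul0r.
by case/orP: ax => ?; rewrite /Num.max;
  case: ltP => ?; case: ltP => ?; case: ltP => ?; lra.
Qed.

Lemma step_left a e x : 0 < e -> x <= a -> step a e x = 0.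
Proof.
move=> e0 xa; rewrite /step !(@max_r _ _ _ 0); [|lra..].
by rewrite expr0n/= mulr0 subr0 addr0 mul0r.
Qed.

Lemma step_right a e x : 0 < e -> a + 2 * e <= x -> step a e x = 1.
Proof.
move=> e0 xa; rewrite /step !(@max_l _ _ _ 0); [|lra..].
by field; rewrite gt_eqF.
Qed.

Lemma step_bounds a e x : 0 < e -> 0 <= step a e x <= 1.
Proof.
move=> e0; have e2 : 0 < 2 * e ^+ 2 by rewrite mulr_gt0 ?exprn_gt0.
rewrite /step divr_ge0 ?ler_pdivrMr ?mul1r//; last exact: ltW.
  rewrite /Num.max; case: ltP => ?; case: ltP => ?; case: ltP => ?; nra.
rewrite /Num.max; case: ltP => ?; case: ltP => ?; case: ltP => ?; nra.
Qed.

End test_functions.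

(** * Weak derivatives and primitives *)

Section weak_derivative_primitive.
Context {R : realType}.
Notation leb := (@lebesgue_measure R).
Implicit Types (f g : R -> R) (a e x : R).

Lemma continuous_integrable_itv f (a b : R) (ba bb : bool) : continuous f ->
  leb.-integrable [set` Interval (BSide ba a) (BSide bb b)] (EFin \o f).
Proof.
move=> cf; have fab : leb.-integrable `[a, b] (EFin \o f).
  by apply: continuous_compact_integrable;
    [exact: segment_compact|exact: continuous_subspaceT].
apply: integrableS fab => //.
by apply: subset_itv; rewrite ?bnd_simp.
Qed.

Lemma integral_tent a e : 0 < e -> \int[leb]_(x in `[a, a + 2 * e]) tent a e x = 1.
Proof.
move=> e0; have cs : continuous (step a e).
  move=> x; apply: differentiable_continuous; apply/derivable1_diffP.
  by have [] := is_derive_step a x e0.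
rewrite /Rintegral (@continuous_FTC2 _ (tent a e) (step a e)).
- by rewrite step_right// step_left// -EFinB subr0.
- by rewrite ltrDl mulr_gt0.
- exact/continuous_subspaceT/continuous_tent.
- split.
  + by move=> x _; have [] := is_derive_step a x e0.
  + exact/cvg_at_right_filter/cs.
  + exact/cvg_at_left_filter/cs.
- by move=> x _; rewrite derive1E; have [_] := is_derive_step a x e0.
Qed.

Lemma integral_mul_tent f a e : 0 < e ->
  \int[leb]_x (f x * tent a e x) =
  \int[leb]_(x in `[a, a + 2 * e]) (f x * tent a e x).
Proof.
move=> e0; rewrite [RHS]Rintegral_mkcond; apply: eq_Rintegral => x _.
by rewrite patchE; case: ifPn => //; rewrite mem_setE => xn; rewrite tent_out ?mulr0.
Qed.

(** The tents are nonnegative, have integral one and live on [[a, a + 2/(n+1)]], so they form an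
    approximate identity at [a]. *)
Lemma cvg_integral_mul_tent f a : continuous f ->
  \int[leb]_x (f x * tent a n.+1%:R^-1 x) @[n --> \oo] --> f a.
Proof.
move=> cf; apply/cvgrPdist_le => eta eta0.
have /cvgrPdist_le/(_ _ eta0)/nbhs_ballP[dl /= dl0 fdl] := cf a.
have dl2 : 0 < 2^-1 * dl by rewrite mulr_gt0.
near=> n.
have e0 : 0 < n.+1%:R^-1 :> R by rewrite invr_gt0.
have ed : 2 * n.+1%:R^-1 < dl.
  rewrite -ltr_pdivlMl//; near: n; exact: (near_infty_natSinv_lt (PosNum dl2)).
move: n.+1%:R^-1 e0 ed => e e0 ed.
have it g : continuous g ->
    leb.-integrable `[a, a + 2 * e] (EFin \o (fun x => g x * tent a e x)).
  move=> cg; apply: continuous_integrable_itv => x.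
  by apply: cvgM; [exact: cg|exact: continuous_tent].
rewrite integral_mul_tent// -[X in `|X - _|]mulr1.
rewrite -[X in `|_ * X - _|](integral_tent a e0).
rewrite -RintegralZl//; last exact/continuous_integrable_itv/continuous_tent.
have cfa : continuous (cst (f a) : R -> R) by move=> x; exact: cvg_cst.
rewrite -RintegralB//; [|exact: (it _ cfa)|exact: it].
apply: (le_trans (le_normr_Rintegral _ _)) => //.
  have -> : EFin \o (fun x => f a * tent a e x - f x * tent a e x) =
      EFin \o (fun x => (f a - f x) * tent a e x).
    by apply/funext => x /=; rewrite mulrBl.
  apply: (it (fun x => f a - f x)) => x.
  by apply: cvgB; [exact: cvg_cst|exact: cf].
have ceta : continuous (cst eta : R -> R) by move=> x; exact: cvg_cst.
rewrite -[leRHS]mulr1 -[X in _ <= _ * X](integral_tent a e0) -RintegralZl//; last first.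
  exact/continuous_integrable_itv/continuous_tent.
apply: le_Rintegral => //; last 2 first.
- exact: (it _ ceta).
- move=> x /=; rewrite in_itv/= => /andP[ax xa].
  rewrite -mulrBl normrM (ger0_norm (tent_ge0 _ _ e0)) ler_wpM2r ?tent_ge0//.
  by apply: fdl; rewrite /ball/= ltr_norml; apply/andP; split; lra.
- have -> : EFin \o (fun x => `|f a * tent a e x - f x * tent a e x|) =
      EFin \o (fun x => `|f a - f x| * tent a e x).
    apply/funext => x /=.
    by rewrite -mulrBl normrM (ger0_norm (tent_ge0 _ _ e0)).
  apply: it => x; apply: cvg_norm.
  by apply: cvgB; [exact: cvg_cst|exact: cf].
Unshelve. all: by end_near. Qed.

(** The test function is [step a e - step b e] with [e] tending to 0. It tends to the indicator of
    []a, b]], while its derivative is a difference of two tents that pick out [f a - f b]. *)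
Lemma weak_derivative_primitive f g : continuous f -> weak_derivative f g ->
  forall a b : R, a < b -> \int[leb]_(x in `]a, b]) g x = f b - f a.
Proof.
move=> cf [lg fg] a b ab; pose e n : R := n.+1%:R^-1.
have e0 n : 0 < e n by rewrite invr_gt0.
have e1 n : e n <= 1 by rewrite invf_le1// ler1n.
pose phi n (x : R) : R := step a (e n) x - step b (e n) x.
have dphi n x : is_derive x 1 (phi n) (tent a (e n) x - tent b (e n) x).
  have -> : phi n = step a (e n) - step b (e n) by apply/funext.
  by apply: is_deriveB; exact: is_derive_step.
have phi'E n : derive1 (phi n) = tent a (e n) \- tent b (e n).
  by apply/funext => x; rewrite derive1E; have [_] := dphi n x.
(* The widths are at most 1, so all supports lie in one bounded interval; this later yields an
   integrable dominating function. *)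
have phi_out n x : x \notin `]a, b + 2] -> phi n x = 0.
  rewrite in_itv/= negb_and -!leNgt -ltNge /phi; have := e1 n; have := e0 n.
  move=> en0 en1 /orP[xa|bx].
    by rewrite !step_left ?subrr//; lra.
  by rewrite !step_right ?subrr//; lra.
have C1phi n : C1c (phi n).
  split.
  - by move=> x; have [] := dphi n x.
  - by rewrite phi'E => x; apply: cvgB; exact: continuous_tent.
  - apply: (subclosed_compact (@closed_closure _ _) (@segment_compact _ a (b + 2))).
    rewrite [X in _ `<=` X](closure_id _).1; last exact: itv_closed.
    apply: closureS => x /= /eqP px; rewrite in_itv/=; apply: contrapT => /negP xab.
    apply: px; apply: phi_out; apply: contra xab; rewrite in_itv/=.
    by move=> /andP[/ltW -> ->].
have phi1 n x : `|phi n x| <= 1.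
  have /andP[? ?] := step_bounds a x (e0 n).
  have /andP[? ?] := step_bounds b x (e0 n).
  by rewrite /phi ler_norml; apply/andP; split; lra.
have mphi n : measurable_fun [set: R] (phi n).
  apply: continuous_measurable_fun => x.
  by apply: differentiable_continuous; apply/derivable1_diffP; have [] := dphi n x.
have [mg _ _] := lg.
have lim_f : \int[leb]_x (f x * derive1 (phi n) x) @[n --> \oo] --> f a - f b.
  have -> : (fun n => \int[leb]_x (f x * derive1 (phi n) x)) =
      (fun n => \int[leb]_x (f x * tent a (e n) x)) -
      (fun n => \int[leb]_x (f x * tent b (e n) x)).
    apply/funext => n; rewrite phi'E.
    under eq_Rintegral do rewrite /= mulrBr.
    have ift c : leb.-integrable setT (EFin \o (fun x => f x * tent c (e n) x)).
      have -> : EFin \o (fun x => f x * tent c (e n) x) =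
          (EFin \o (fun x => f x * tent c (e n) x)) \_ `[c, c + 2 * e n].
        apply/funext => x; rewrite patchE; case: ifPn => //=.
        by rewrite mem_setE => xn; rewrite tent_out ?mulr0.
      apply/integrable_restrict => //; rewrite setTI.
      apply: continuous_integrable_itv => x.
      by apply: cvgM; [exact: cf|exact: continuous_tent].
    by rewrite RintegralB.
  by apply: cvgB; exact: cvg_integral_mul_tent.
have lim_g : \int[leb]_x (g x * phi n x) @[n --> \oo] --> \int[leb]_(x in `]a, b]) g x.
  have gfin : (\int[leb]_(x in `]a, b]) (g x)%:E)%E \is a fin_num.
    by apply: integrable_fin_num => //; exact: locally_integrable_itv.
  apply: fine_cvg; rewrite fineK// integral_mkcond.
  have := @dominated_convergence _ _ R leb setT measurableT
    (fun n x => (g x * phi n x)%:E) ((EFin \o g) \_ `]a, b])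
    ((EFin \o (fun x => `|g x|)) \_ `]a, b + 2]).
  case => //.
  - move=> n; apply/measurable_EFinP; exact: (measurable_funM mg (mphi n)).
  - apply/(measurable_restrictT _ _).1 => //.
    exact/measurable_EFinP/measurable_funTS.
  (* At each [x] the sequence is eventually constant: 0 up to [a], then [g x] on []a, b]] once the
     first step is completed before [x], and 0 beyond [b] once both are. *)
  - apply: aeW => x _; apply: cvg_near_cst.
    have [xa|ax] := leP x a.
      apply: nearW => n; rewrite patchE memNset/=; last by rewrite in_itv/=; lra.
      by rewrite phi_out ?mulr0// in_itv/=; lra.
    have [xb|bx] := leP x b.
      rewrite patchE mem_set/=; last by rewrite in_itv/=; lra.
      have xa0 : 0 < (x - a) / 2 by lra.
      near=> n; rewrite /phi (step_left (e0 n) xb) step_right ?subr0 ?mulr1//.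
      suff : e n < (x - a) / 2 by lra.
      by near: n; exact: (near_infty_natSinv_lt (PosNum xa0)).
    rewrite patchE memNset/=; last by rewrite in_itv/=; lra.
    have xa0 : 0 < (x - b) / 2 by lra.
    near=> n; have en : e n < (x - b) / 2.
      by near: n; exact: (near_infty_natSinv_lt (PosNum xa0)).
    by rewrite /phi !step_right ?subrr ?mulr0//; lra.
  - apply/integrable_restrict => //; rewrite setTI.
    exact/integrable_norm/locally_integrable_itv.
  - apply: aeW => x n _; rewrite patchE; case: ifPn.
      by move=> _ /=; rewrite lee_fin normrM ler_piMr.
    by rewrite mem_setE => xn; rewrite phi_out// mulr0 abse0.
have lim_fg : \int[leb]_x (f x * derive1 (phi n) x) @[n --> \oo] -->
    - \int[leb]_(x in `]a, b]) g x.
  have -> : (fun n => \int[leb]_x (f x * derive1 (phi n) x)) =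
      - (fun n => \int[leb]_x (g x * phi n x)).
    by apply/funext => n; rewrite fg.
  exact: cvgN.
by rewrite -[LHS]opprK -(cvg_unique _ lim_f lim_fg)// opprB.
Unshelve. all: by end_near. Qed.

End weak_derivative_primitive.

(** * Densities of monotone Lipschitz functions *)

Section lipschitz_density.
Context {R : realType}.
Notation leb := (@lebesgue_measure R).
Implicit Types (F g : R -> R).

Lemma lebesgue_stieltjes_itvoc (f : cumulative R R) (a b : R) : a <= b ->
  lebesgue_stieltjes_measure f `]a, b]%classic = (f b - f a)%:E.
Proof.
move=> ab; rewrite /lebesgue_stieltjes_measure /measure_extension/=.
rewrite measurable_mu_extE/=; last exact: is_ocitv.
by rewrite wlength_itv_bnd.
Qed.

(** The Stieltjes measures of [F] and of [C x - F] add up to [C] times Lebesgue measure. Hence the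
    former is absolutely continuous, and Radon-Nikodym supplies its density. *)
Lemma lipschitz_density F (C : R) : 0 <= C ->
  {homo F : x y / x <= y} -> (forall x y, x <= y -> F y - F x <= C * (y - x)) ->
  exists g, [/\ measurable_fun [set: R] g, forall x, 0 <= g x &
    forall a b : R, a < b ->
      (\int[leb]_(x in `]a, b]) (g x)%:E = (F b - F a)%:E)%E].
Proof.
move=> C0 ndF lipF.
have rcont (f : R -> R) (K : R) :
    (forall x y, x <= y -> 0 <= f y - f x <= K * (y - x)) ->
    right_continuous f.
  move=> fK x; apply/cvgrPdist_le => e e0.
  have eK : 0 < e / (`|K| + 1) by rewrite divr_gt0// ltr_wpDl.
  near=> y.
  have xy : x <= y by apply/ltW; near: y; exact: nbhs_right_gt.
  have /andP[f0 fy] := fK _ _ xy.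
  rewrite distrC ger0_norm// (le_trans fy)//.
  have yx : y - x <= e / (`|K| + 1).
    by rewrite lerBlDl; apply/ltW; near: y; apply: nbhs_right_lt; rewrite ltrDl.
  rewrite (le_trans (ler_wpM2r _ (ler_norm K))) ?subr_ge0//.
  rewrite (le_trans (ler_wpM2l _ yx))// mulrCA ger_pMr//.
  by rewrite ler_pdivrMr ?mul1r ?lerDl// ltr_wpDl.
have cumul (f : R -> R) (K : R) :
    (forall x y, x <= y -> 0 <= f y - f x <= K * (y - x)) ->
    exists c : cumulative R R, c = f :> (R -> R).
  move=> fK; have nd : nondecreasing f.
    by move=> x y /fK/andP[]; rewrite subr_ge0.
  pose m := isCumulative.Build R _ R f nd (rcont _ _ fK).
  by exists (HB.pack_for (cumulative R R) f m).
have [cF cFE] : exists c : cumulative R R, c = F :> (R -> R).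
  by apply: (cumul _ C) => x y xy; rewrite subr_ge0 ndF//= lipF.
have [cG cGE] : exists c : cumulative R R, c = (fun x => C * x - F x) :> (R -> R).
  apply: (cumul _ C) => x y xy; have := ndF _ _ xy; have := lipF _ _ xy.
  by move=> ? ?; apply/andP; split; lra.
have [cC cCE] : exists c : cumulative R R, c = (fun x => C * x) :> (R -> R).
  apply: (cumul _ C) => x y xy; rewrite -mulrBr lexx andbT.
  by rewrite mulr_ge0 ?subr_ge0.
pose lF : {measure set (measurableTypeR R) -> \bar R} := lebesgue_stieltjes_measure cF.
pose lG : {measure set (measurableTypeR R) -> \bar R} := lebesgue_stieltjes_measure cG.
have addFG A : measurable A -> (lF A + lG A = C%:E * leb A)%E.
  move=> mA.
  have e1 : lebesgue_stieltjes_measure cC A = measure_add lF lG A.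
    apply: lebesgue_stieltjes_measure_unique mA => _ [[a b]] _ <-.
    apply: etrans (esym (measure_addE lF lG _)) => /=.
    have [ab|ba] := leP a b; last first.
      by rewrite set_itv_ge ?measure0 ?adde0// bnd_simp -leNgt ltW.
    rewrite /lF /lG !lebesgue_stieltjes_itvoc// cFE cGE cCE.
    by rewrite -EFinD; congr EFin; lra.
  have e2 : lebesgue_stieltjes_measure cC A = mscale (NngNum C0) leb A.
    apply: lebesgue_stieltjes_measure_unique mA => _ [[a b]] _ <- /=.
    have [ab|ba] := leP a b; last by rewrite set_itv_ge ?measure0// bnd_simp -leNgt ltW.
    rewrite /mscale/= [leb _]lebesgue_stieltjes_itvoc// lebesgue_stieltjes_itvoc// cCE.
    by rewrite -EFinM; congr EFin => /=; lra.
  by rewrite -measure_addE -e1 e2.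
have lF0 A : measurable A -> leb A = 0%E -> lF A = 0%E.
  move=> mA A0; have := addFG _ mA; rewrite A0 mule0 => /eqP.
  by rewrite padde_eq0 ?measure_ge0// => /andP[/eqP].
(* Radon-Nikodym is applied to each term of a decomposition into finite measures, and the densities
   are summed. *)
pose s := sfinite_measure_seq (lebesgue_stieltjes_measure cF).
have sE A : measurable A -> lF A = (\sum_(n <oo) s n A)%E.
  exact: (sfinite_measure_seqP (lebesgue_stieltjes_measure cF)).
have sdom n : s n `<< leb.
  apply/null_content_dominatesP => A mA A0; apply/eqP; rewrite -measure_le0.
  rewrite -(lF0 _ mA A0) (sE _ mA).
  have := @nneseries_lim_ge R (s ^~ A) xpredT 0 n.+1 (fun k _ _ => measure_ge0 _ _).
  apply: le_trans; rewrite big_nat_recr// leeDr//.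
  by apply: sume_ge0 => i _; exact: measure_ge0.
have /choice[f fP] n := radon_nikodym_sigma_finite (sdom n).
have f0 n x : (0 <= f n x)%E by have [] := fP n.
have mf n : measurable_fun [set: measurableTypeR R] (f n).
  by have [_ _ /measurable_int] := fP n.
pose g x := (\sum_(n <oo) f n x)%E.
have g0 x : (0 <= g x)%E by apply: nneseries_ge0.
have mg : measurable_fun [set: measurableTypeR R] g.
  by apply: ge0_emeasurable_sum => // n x _; exact: f0.
have gE A : measurable A -> lF A = (\int[leb]_(x in A) g x)%E.
  move=> mA; rewrite (sE _ mA) integral_nneseries//; last first.
    by move=> n; exact: measurable_funTS.
  by apply: eq_eseriesr => n _; have [_ _ _ ->] := fP n.
(* Over a bounded interval [g] has a finite integral, so it is finite almost everywhere and [fine]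
   alters it only on a null set. *)
exists (fine \o g); split.
- exact: measurableT_comp.
- by move=> x; rewrite fine_ge0.
- move=> a b ab; have Fab : lF `]a, b]%classic = (F b - F a)%:E.
    by rewrite [LHS]lebesgue_stieltjes_itvoc ?cFE// ltW.
  have ig : leb.-integrable `]a, b] g.
    apply/integrableP; split; first exact: measurable_funTS.
    under eq_integral do rewrite gee0_abs//.
    by rewrite -gE// Fab ltry.
  rewrite -Fab gE//; apply: ge0_ae_eq_integral => //.
  + by apply/measurable_EFinP; apply: measurable_funTS; exact: measurableT_comp.
  + exact: measurable_funTS.
  + by move=> x _; rewrite lee_fin fine_ge0.
  + apply: (@filterS _ _ (ae_filter_ringOfSetsType leb) _ _ _
      (integrable_ae _ ig)) => // x gx xab.
    by rewrite /= fineK// gx.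
Unshelve. all: by end_near. Qed.

(** Bisecting [n] times leaves [2^n] pieces, each contributing at most [K (b - a)^2 / 4^n]; the
    total is at most [K (b - a)^2 / 2^n]. *)
Lemma small_additive_eq0 (E : R -> R -> R) (K : R) :
  (forall a m b, a < m -> m < b -> E a b = E a m + E m b) ->
  (forall a b, a < b -> `|E a b| <= K * (b - a) ^+ 2) ->
  forall a b, a < b -> E a b = 0.
Proof.
move=> addE sE a b ab.
have dyadic n : forall a b, a < b -> `|E a b| <= K * (b - a) ^+ 2 / 2 ^+ n.
  elim: n => [|n IH] {}a {}b {}ab; first by rewrite expr0 divr1 sE.
  rewrite (addE a ((a + b) / 2) b); [|lra..].
  apply: (le_trans (ler_normD _ _)).
  have /IH h1 : a < (a + b) / 2 by lra.
  have /IH h2 : (a + b) / 2 < b by lra.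
  apply: (le_trans (lerD h1 h2)); rewrite [2 ^+ n.+1]exprS invfM.
  by move: (2 ^+ n)^-1 => t; rewrite le_eqVlt; apply/orP; left; apply/eqP; field.
apply/eqP; rewrite -normr_le0; apply/ler_addgt0Pl => e e0; rewrite addr0.
pose M := `|K * (b - a) ^+ 2|.
have [n Mn] : exists n : nat, M / e <= 2 ^+ n.
  exists (Num.truncn (M / e)).+1.
  rewrite (le_trans (ltW (truncnS_gt _)))// -natrX ler_nat.
  exact/ltnW/ltn_expl.
apply: (le_trans (dyadic n _ _ ab)); rewrite ler_pdivrMr ?exprn_gt0//.
by rewrite (le_trans (ler_norm _))// [leRHS]mulrC -ler_pdivrMr.
Qed.

End lipschitz_density.

(** * Integration by parts against test functions *)

Section weak_derivative_of_primitive.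
Context {R : realType}.
Notation leb := (@lebesgue_measure R).
Implicit Types (F g phi : R -> R).

Lemma integrableD_EFin (D : set (measurableTypeR R)) (f g : R -> R) : measurable D ->
  leb.-integrable D (EFin \o f) -> leb.-integrable D (EFin \o g) ->
  leb.-integrable D (EFin \o (fun x => f x + g x)).
Proof. by move=> mD fi gi; apply: (integrableD mD fi gi). Qed.

Lemma integrableB_EFin (D : set (measurableTypeR R)) (f g : R -> R) : measurable D ->
  leb.-integrable D (EFin \o f) -> leb.-integrable D (EFin \o g) ->
  leb.-integrable D (EFin \o (fun x => f x - g x)).
Proof. by move=> mD fi gi; exact: (integrableB mD fi gi). Qed.

Lemma integrableZl_EFin (D : set (measurableTypeR R)) (f : R -> R) (k : R) :
  measurable D ->
  leb.-integrable D (EFin \o f) -> leb.-integrable D (EFin \o (fun x => k * f x)).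
Proof. by move=> mD fi; exact: (integrableZl mD k fi). Qed.

Lemma compactly_supported_bound phi : compactly_supported phi ->
  exists2 M : R, 0 < M & forall x, M < `|x| -> phi x = 0.
Proof.
move=> /compact_bounded[M [_ phiM]]; exists (`|M| + 1) => [|x Mx].
  by rewrite ltr_wpDl.
apply: contrapT => /eqP phix.
have := phiM (`|M| + 1); rewrite (le_lt_trans (ler_norm M)) ?ltrDl// => /(_ isT x).
have cx : closure [set x | phi x != 0] x by exact: subset_closure.
by move=> /(_ cx) /=; rewrite leNgt Mx.
Qed.

Lemma C1c_derive_bound phi : C1c phi -> exists M D : R, [/\ 0 < M, 0 <= D,
  forall x, M <= `|x| -> phi x = 0 /\ derive1 phi x = 0,
  forall x, `|derive1 phi x| <= D &
  forall x y, x <= y -> `|phi y - phi x| <= D * (y - x)].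
Proof.
move=> [dphi cphi' /compactly_supported_bound[M M0 phi0]].
have phi'0 x : M < `|x| -> derive1 phi x = 0.
  move=> Mx; rewrite derive1E.
  have -> : 'D_1 phi x = 'D_1 (cst 0 : R -> R) x; last by rewrite derive_cst.
  apply: near_eq_derive; near=> y; apply: phi0.
  near: y; have cn : `|y| @[y --> x] --> `|x| by apply: cvg_norm; exact: cvg_id.
  exact: (cvgr_gt _ cn).
have [c _ cmax] : exists2 c, c \in `[- M, M] &
    forall t, t \in `[- M, M] -> `|derive1 phi t| <= `|derive1 phi c|.
  apply: EVT_max; first by lra.
  by apply: continuous_subspaceT => x; apply: cvg_norm; exact: cphi'.
have D x : `|derive1 phi x| <= `|derive1 phi c|.
  have [Mx|xM] := ltP M `|x|; first by rewrite phi'0// normr0.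
  by apply: cmax; rewrite in_itv/= -ler_norml.
(* Vanishing is known for [|x| > M]; the radius [M + 1] makes it hold on the boundary as well. *)
exists (M + 1), `|derive1 phi c|; split => //.
- by lra.
- by move=> x Mx; rewrite phi0 ?phi'0//; lra.
- move=> x y xy.
  have [z _ ->] : exists2 z, z \in `[x, y] & phi y - phi x = derive1 phi z * (y - x).
    apply: MVT_segment => //.
      by move=> z _; rewrite derive1E; exact/derivableP/dphi.
    apply: continuous_subspaceT => z.
    exact/differentiable_continuous/derivable1_diffP/dphi.
  by rewrite normrM ler_pM// ger0_norm// subr_ge0.
Unshelve. all: by end_near. Qed.

Lemma lipschitz_continuous F (C : R) : 0 <= C ->
  (forall x y, x <= y -> `|F y - F x| <= C * (y - x)) -> continuous F.
Proof.
move=> C0 lipF x; apply/cvgrPdist_le => e e0.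
have eC : 0 < e / (C + 1) by rewrite divr_gt0// ltr_wpDl.
near=> y.
have xy : `|x - y| <= e / (C + 1).
  by near: y; apply: cvgr_dist_le => //; exact: cvg_id.
have le : `|F x - F y| <= C * `|x - y|.
  have [xley|/ltW yx] := leP x y.
    rewrite distrC [X in C * X]distrC (le_trans (lipF _ _ xley))//.
    by rewrite ler_wpM2l// ler_norm.
  by rewrite (le_trans (lipF _ _ yx))// ler_wpM2l// ler_norm.
rewrite (le_trans le)// (le_trans (ler_wpM2l C0 xy))// mulrCA ger_pMr//.
by rewrite ler_pdivrMr ?mul1r ?lerDl// ltr_wpDl.
Unshelve. all: by end_near. Qed.

Lemma Rintegral_itv_setU (f : R -> R) (a m b : R) : a < m -> m < b ->
  leb.-integrable `]a, b] (EFin \o f) ->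
  \int[leb]_(x in `]a, b]) f x =
  \int[leb]_(x in `]a, m]) f x + \int[leb]_(x in `]m, b]) f x.
Proof.
move=> am mb fi; rewrite -(@Rintegral_itvB _ f _ _ m fi) ?bnd_simp; [|lra..].
by rewrite addrC subrK.
Qed.

Lemma Rintegral_itvoc_cst (c a b : R) : a < b ->
  \int[leb]_(x in `]a, b]) c = c * (b - a).
Proof.
move=> ab; have lab : leb `]a, b]%classic = (b - a)%:E.
  by rewrite lebesgue_measure_itv/= lte_fin ab.
by rewrite Rintegral_cst// -[b - a]/(fine (b - a)%:E) -lab.
Qed.

(** Integration by parts on intervals: the defect [E a b] is additive in the interval and of order
    [(b - a)^2], hence zero. *)
Lemma weak_derivative_of_primitive F g (C : R) : 0 <= C ->
  (forall x y, x <= y -> `|F y - F x| <= C * (y - x)) ->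
  measurable_fun [set: R] g -> (forall x, 0 <= g x) ->
  (forall a b : R, a < b ->
    (\int[leb]_(x in `]a, b]) (g x)%:E = (F b - F a)%:E)%E) ->
  weak_derivative F g.
Proof.
move=> C0 lipF mg g0 gF; have cF := lipschitz_continuous C0 lipF.
have ig (a b : R) : a < b -> leb.-integrable `]a, b] (EFin \o g).
  move=> ab; apply/integrableP; split; first exact/measurable_EFinP/measurable_funTS.
  by under eq_integral do rewrite /= ger0_norm//; rewrite gF// ltry.
have lg : locally_integrable [set: R] g.
  split => //; first exact: openT.
  move=> K _ /[dup] cK /compact_bounded[M [_ KM]].
  pose N := `|M| + 1.
  have MN : M < N by rewrite (le_lt_trans (ler_norm M))// ltrDl.
  have N0 : 0 < N by rewrite ltr_wpDl.
  pose a := - (N + 1); pose b := N + 1.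
  have ab : a < b by rewrite /a /b; lra.
  apply: (@le_lt_trans _ _ (\int[leb]_(x in `]a, b]) `|g x|%:E)%E).
    apply: ge0_subset_integral => //.
    - exact: compact_measurable.
    - by apply/measurable_EFinP; apply: measurable_funTS; exact: measurableT_comp.
    - by move=> x Kx; have := KM _ MN _ Kx; rewrite /= in_itv/= ler_norml /a /b; lra.
  under eq_integral do rewrite /= ger0_norm//.
  by rewrite gF ?ltry.
split => // phi /[dup] C1phi /C1c_derive_bound[M [D [M0 D0 phi0 phi'D lipphi]]].
have [dphi cphi' _] := C1phi.
have cphi := lipschitz_continuous D0 lipphi.
have mphi : measurable_fun [set: R] phi by exact: continuous_measurable_fun.
have iFphi (a b : R) : leb.-integrable `]a, b] (EFin \o (fun x => F x * derive1 phi x)).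
  by apply: continuous_integrable_itv => x; apply: cvgM; [exact: cF|exact: cphi'].
have igphi (a b : R) : a < b ->
    leb.-integrable `]a, b] (EFin \o (fun x => g x * phi x)).
  move=> ab; pose B := `|phi a| + D * (b - a).
  have iBg : leb.-integrable `]a, b] (fun x => B%:E * (EFin \o g) x)%E.
    by apply: integrableZl => //; exact: ig.
  apply: le_integrable iBg => //.
    by apply/measurable_EFinP; apply: measurable_funTS; exact: measurable_funM.
  move=> x /=; rewrite in_itv/= => /andP[ax xb].
  rewrite lee_fin !normrM mulrC ler_wpM2r//.
  rewrite (le_trans _ (ler_norm _))// /B -[phi x](subrK (phi a)).
  rewrite (le_trans (ler_normD _ _))// addrC lerD2l.
  by rewrite (le_trans (lipphi _ _ (ltW ax)))// ler_wpM2l// lerB.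
pose E a b := \int[leb]_(x in `]a, b]) (F x * derive1 phi x)
  + \int[leb]_(x in `]a, b]) (g x * phi x) - (F b * phi b - F a * phi a).
have E0 : forall a b, a < b -> E a b = 0.
  apply: (@small_additive_eq0 _ _ (2 * C * D)).
    move=> a m b am mb; rewrite /E.
    rewrite (Rintegral_itv_setU am mb (iFphi _ _)).
    by rewrite (Rintegral_itv_setU am mb (igphi _ _ _)); lra.
  move=> a b ab.
  have ba0 : 0 <= b - a by lra.
  have iphi' : leb.-integrable `]a, b] (EFin \o derive1 phi).
    exact: continuous_integrable_itv.
  have intphi' : \int[leb]_(x in `]a, b]) (derive1 phi x) = phi b - phi a.
    rewrite Rintegral_itv_obnd_cbnd// /Rintegral (@continuous_FTC2 _ _ phi)//.
    - exact: continuous_subspaceT.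
    - split; first by move=> x _; exact: dphi.
      + exact/cvg_at_right_filter/cphi.
      + exact/cvg_at_left_filter/cphi.
  have intg : \int[leb]_(x in `]a, b]) (g x) = F b - F a by rewrite /Rintegral gF.
  have [iFp igp ig'] := And3 (iFphi a b) (igphi a b ab) (ig a b ab).
  have iFb : leb.-integrable `]a, b] (EFin \o (fun x => F b * derive1 phi x)).
    exact: integrableZl_EFin.
  have ipa : leb.-integrable `]a, b] (EFin \o (fun x => phi a * g x)).
    exact: integrableZl_EFin.
  have iB1 : leb.-integrable `]a, b]
      (EFin \o (fun x => F x * derive1 phi x - F b * derive1 phi x)).
    exact: integrableB_EFin.
  have iB2 : leb.-integrable `]a, b]
      (EFin \o (fun x => g x * phi x - phi a * g x)).
    exact: integrableB_EFin.
  have icst (c : R) : leb.-integrable `]a, b] (EFin \o (fun=> c)).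
    by apply: continuous_integrable_itv => x; exact: cvg_cst.
  have iDg : leb.-integrable `]a, b] (EFin \o (fun x => D * (b - a) * g x)).
    exact: integrableZl_EFin.
  (* Freezing [F] at [b] in the first integral and [phi] at [a] in the second reproduces the
     boundary term exactly: [F b (phi b - phi a) + phi a (F b - F a) = F b phi b - F a phi a]. *)
  have EE : E a b = \int[leb]_(x in `]a, b])
      ((F x * derive1 phi x - F b * derive1 phi x) + (g x * phi x - phi a * g x)).
    rewrite RintegralD// RintegralB// RintegralB// !RintegralZl//.
    by rewrite intphi' intg /E; lra.
  have iall : leb.-integrable `]a, b] (EFin \o (fun x =>
      (F x * derive1 phi x - F b * derive1 phi x) + (g x * phi x - phi a * g x))).
    exact: integrableD_EFin.
  rewrite EE (le_trans (le_normr_Rintegral _ iall))//.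
  (* Both frozen differences are at most their Lipschitz constant times [b - a]. As [g] has integral
     at most [C (b - a)], the two terms together give [2 C D (b - a)^2]. *)
  apply: (@le_trans _ _ (\int[leb]_(x in `]a, b])
      (C * D * (b - a) + D * (b - a) * g x))).
    apply: le_Rintegral => //.
    - exact: integrable_norm.
    - by apply: integrableD_EFin; first exact: measurable_itv.
    - move=> x /=; rewrite in_itv/= => /andP[ax xb].
      rewrite -mulrBl [phi a * _]mulrC -mulrBr.
      rewrite (le_trans (ler_normD _ _))// !normrM (ger0_norm (g0 x)).
      apply: lerD.
        rewrite mulrAC ler_pM// distrC (le_trans (lipF _ _ xb))// ler_wpM2l//; lra.
      rewrite mulrC ler_wpM2r// (le_trans (lipphi _ _ (ltW ax)))// ler_wpM2l//; lra.
  rewrite RintegralD// (@RintegralZl _ _ _ leb _ g)//.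
  rewrite intg Rintegral_itvoc_cst//.
  have := lipF _ _ (ltW ab); rewrite ler_norml => /andP[_ FC].
  have : D * (b - a) * (F b - F a) <= D * (b - a) * (C * (b - a)).
    by rewrite ler_wpM2l// mulr_ge0.
  lra.
(* From [M] outwards [phi] and its derivative vanish, so integrals over the line reduce to []-M,
   M]], where the boundary term is zero. *)
have MM : - M < M by lra.
have restr (f : R -> R) : (forall x, M <= `|x| -> f x = 0) ->
    \int[leb]_x f x = \int[leb]_(x in `](- M), M]) f x.
  move=> f0; rewrite [RHS]Rintegral_mkcond; apply: eq_Rintegral => x _.
  rewrite patchE; case: ifPn => //; rewrite mem_setE in_itv/= => xM.
  by rewrite f0// leNgt; apply: contra xM; rewrite ltr_norml => /andP[-> /ltW ->].
have [pM pNM] : phi M = 0 /\ phi (- M) = 0.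
  by split; apply: (phi0 _ _).1; rewrite ?normrN ler_norm.
have := E0 _ _ MM; rewrite /E pM pNM.
rewrite -(restr (fun x => F x * derive1 phi x)); last first.
  by move=> x /phi0[_ ->]; rewrite mulr0.
rewrite -(restr (fun x => g x * phi x)); last first.
  by move=> x /phi0[-> _]; rewrite mulr0.
by rewrite !mulr0; lra.
Qed.

Lemma lipschitz_weak_derivative F (C : R) : 0 <= C ->
  {homo F : x y / x <= y} -> (forall x y, x <= y -> F y - F x <= C * (y - x)) ->
  exists g, weak_derivative F g.
Proof.
move=> C0 ndF lipF; have [g [mg g0 gF]] := lipschitz_density C0 ndF lipF.
exists g; apply: (weak_derivative_of_primitive C0) => // x y xy.
by rewrite ger0_norm ?lipF// subr_ge0 ndF.
Qed.

Lemma wderivP F : (exists g, weak_derivative F g) -> weak_derivative F (wderiv F).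
Proof. by move=> [g Fg]; rewrite /wderiv; exact: (xgetPex _ (ex_intro _ g Fg)). Qed.

End weak_derivative_of_primitive.

(** * Periodic integrals and relabelings *)

Section periodic_integrals.
Context {R : realType}.
Notation leb := (@lebesgue_measure R).
Implicit Types (f g : R -> R) (t : R -> \bar R) (a b : R).
Local Open Scope ereal_scope.

Lemma lebesgue_itvco a b : (a < b)%R ->
  (leb : {measure set (measurableTypeR R) -> \bar R}) `[a, b[%classic = (b - a)%:E.
Proof.
by move=> ab; apply: (etrans (lebesgue_measure_itv _)); rewrite /= lte_fin ab.
Qed.

Lemma integral_itvco_itvoc t a b : measurable_fun [set: R] t ->
  \int[leb]_(x in `[a, b[) t x = \int[leb]_(x in `]a, b]) t x.
Proof.
move=> mt; have mD (D : set R) : measurable_fun D t by exact: measurable_funTS.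
by rewrite integral_itv_bndo_bndc// integral_itv_obnd_cbnd.
Qed.

Lemma ge0_integral_itvoc_setU t a m b : measurable_fun [set: R] t ->
  (forall x, 0 <= t x) -> (a <= m)%R -> (m <= b)%R ->
  \int[leb]_(x in `]a, b]) t x =
  \int[leb]_(x in `]a, m]) t x + \int[leb]_(x in `]m, b]) t x.
Proof.
move=> mt t0 am mb; rewrite -ge0_integral_setU//.
- by congr (integral _ _ _); apply/seteqP; split=> x /=; rewrite !in_itv/=;
    [case: (leP x m); lra|lra].
- exact: measurable_funTS.
- by apply/disj_setPS => x /= []; rewrite !in_itv/=; lra.
Qed.

Lemma ge0_integral_shift t (c : R) : measurable_fun [set: R] t ->
  (forall x, 0 <= t x) -> \int[leb]_x t (x + c)%R = \int[leb]_x t x.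
Proof.
move=> mt t0; have mphi : measurable_fun [set: R] (fun x : R => x + c)%R.
  exact: measurable_funD.
have := @transfer_itvco R leb (fun x => x + c)%R (cst 1)%R mphi
  (measurable_cst _) (fun=> ler01).
move=> /(_ _ _ t mt t0)<-.
- by apply: eq_integral => x _; rewrite /= mule1.
- move=> a b; have [ab|ba] := ltP a b; first by rewrite lebesgue_itvco// ltry.
  by rewrite set_itv_ge ?measure0// bnd_simp -leNgt.
- move=> a b ab; rewrite lebesgue_itvco//.
  rewrite [X in integral _ X _](_ : _ = `[a - c, b - c[%classic)%R; last first.
    by apply/seteqP; split=> x /=; rewrite !in_itv/=; lra.
  apply: (etrans (integral_cst leb (measurable_itv _) 1)); rewrite mul1e.
  by apply: (etrans (lebesgue_itvco _)); [lra|congr EFin; lra].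
Qed.

Lemma integral_itvoc_shift t a b : measurable_fun [set: R] t ->
  (forall x, 0 <= t x) ->
  \int[leb]_(x in `](a + 1)%R, (b + 1)%R]) t x =
  \int[leb]_(x in `]a, b]) t (x + 1)%R.
Proof.
move=> mt t0; rewrite [LHS]integral_mkcond [RHS]integral_mkcond.
rewrite -(ge0_integral_shift 1).
- apply: eq_integral => x _; rewrite /= !patchE.
  by rewrite !mem_setE !in_itv/= ltrD2r lerD2r.
- exact/(measurable_restrictT _ _).1/measurable_funTS.
- by move=> x; rewrite patchE; case: ifP.
Qed.

Lemma integral_ae_periodic t : measurable_fun [set: R] t ->
  (forall x, 0 <= t x) -> (\forall x \ae leb, t (x + 1)%R = t x) ->
  forall a, \int[leb]_(x in `]a, (a + 1)%R]) t x = \int[leb]_(x in `]0%R, 1%R]) t x.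
Proof.
move=> mt t0 tper.
have step a b : \int[leb]_(x in `](a + 1)%R, (b + 1)%R]) t x =
    \int[leb]_(x in `]a, b]) t x.
  rewrite integral_itvoc_shift//; apply: ge0_ae_eq_integral => //.
  - apply: measurable_funTS; apply: measurableT_comp => //.
    exact: measurable_funD.
  - exact: measurable_funTS.
  - by apply: (@filterS _ _ (ae_filter_ringOfSetsType leb) _ _ _ tper) => x + _.
have stepn n a b : \int[leb]_(x in `](a + n%:R)%R, (b + n%:R)%R]) t x =
    \int[leb]_(x in `]a, b]) t x.
  elim: n => [|n IH]; first by rewrite !addr0.
  by rewrite -natr1 !addrA step.
have pos a : (0 <= a)%R ->
    \int[leb]_(x in `]a, (a + 1)%R]) t x = \int[leb]_(x in `]0%R, 1%R]) t x.
  move=> a0; have /andP[ka ak] := truncn_itv a0.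
  (* With [k] the integer part of [a], the piece of []a, a + 1]] beyond [k + 1] is moved back to
     []k, a]]; with the remaining piece it makes up []k, k + 1]]. *)
  set k := (Num.truncn a)%:R : R; rewrite -/k -natr1 -/k in ka ak.
  rewrite (@ge0_integral_itvoc_setU _ _ (k + 1)%R)//; [|lra..].
  rewrite step addeC -ge0_integral_itvoc_setU//; last by lra.
  by rewrite -(stepn (Num.truncn a) 0%R 1%R) add0r addrC.
move=> a; have [/pos//|a0] := leP 0%R a.
rewrite -(stepn (Num.truncn `|a|).+1) addrAC; apply: pos.
have := truncnS_gt `|a|%R; rewrite ltr0_norm//; lra.
Qed.

End periodic_integrals.

Section quasiperiodic.
Context {R : realType}.
Implicit Types f : R -> R.

Lemma quasiperiodicz f (c : R) : (forall x, f (x + 1) = f x + c) ->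
  forall (n : int) x, f (x + n%:~R) = f x + c * n%:~R.
Proof.
move=> fc.
have fn (n : nat) x : f (x + n%:R) = f x + c * n%:R.
  elim: n => [|n IH]; first by rewrite mulr0 !addr0.
  by rewrite -natr1 addrA fc IH mulrDr mulr1 addrA.
case=> n x; first exact: fn.
have := fn n.+1 (x - n.+1%:R); rewrite subrK => ->.
by rewrite NegzE mulrNz mulrN addrK.
Qed.

Lemma periodicz f : (forall x, f (x + 1) = f x) ->
  forall (n : int) x, f (x + n%:~R) = f x.
Proof.
move=> f1 n x; rewrite (@quasiperiodicz f 0) ?mul0r ?addr0// => z.
by rewrite f1 addr0.
Qed.

End quasiperiodic.

Section relabeling.
Context {R : realType}.
Notation leb := (@lebesgue_measure R).
Implicit Types (f : R -> R) (a b : R).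

(** A continuous injection of the line is monotone, and [f 1 = f 0 + 1] fixes the direction. *)
Lemma inG_le f : inG f -> {mono f : x y / x <= y}.
Proof.
move=> [bf [[cf _] _] f1 _ _] x y.
have := @itv_continuous_inj_le R f `]-oo, +oo[; apply; rewrite ?in_itv//=.
- by exists 0, 1; rewrite !in_itv/= ltr01 -[X in _ <= f X]add0r f1 lerDl.
- exact: continuous_subspaceT.
- by move=> u v _ _; exact: (bij_inj bf).
Qed.

(** The absolute value gives a density that is nonnegative everywhere. Since [f] is increasing, it
    changes [wderiv f] only on a null set. *)
Lemma inG_abs_wderiv f : inG f ->
  measurable_fun [set: R] (wderiv f) /\
  forall a b, a < b ->
    (\int[leb]_(x in `]a, b]) `|wderiv f x|%:E = (f b - f a)%:E)%E.
Proof.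
move=> Gf; have mf := inG_le Gf; have [_ [[cf wf] _] _ _ _] := Gf.
have /[dup] [[lw _]] := wderivP wf.
move=> /(weak_derivative_primitive cf) ftc.
have [mw _ _] := lw; split => // a b ab.
have w0 : \forall x \ae leb, 0 <= wderiv f x.
  by apply: ae_ge0_of_integral_ge0 => // c d cd; rewrite ftc// subr_ge0 mf ltW.
have iw : leb.-integrable `]a, b] (EFin \o wderiv f).
  exact: locally_integrable_itv.
rewrite -ftc// /Rintegral fineK; last exact: integrable_fin_num.
apply: ae_eq_integral => //.
- by apply/measurable_EFinP; apply: measurable_funTS; exact: measurableT_comp.
- by apply/measurable_EFinP; apply: measurable_funTS.
- apply: (@filterS _ _ (ae_filter_ringOfSetsType leb) _ _ _ w0) => x x0 _ /=.
  by rewrite ger0_norm.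
Qed.

(** [f] pushes [|wderiv f| dx] forward to Lebesgue measure, because the preimage of [[c, d[] has
    mass [d - c]; the period []0, 1]] is the preimage of []f 0, f 0 + 1]]. *)
Lemma inG_change_of_variables f (t : R -> \bar R) : inG f ->
  measurable_fun [set: R] t -> (forall x, (0 <= t x)%E) ->
  (\int[leb]_(x in `]0%R, 1%R]) (t (f x) * `|wderiv f x|%:E) =
   \int[leb]_(x in `](f 0)%R, (f 0 + 1)%R]) t x)%E.
Proof.
move=> Gf mt t0; have mf := inG_le Gf.
have [[h fh hf] [[cf _] _] f1 _ _] := Gf.
have lf := leW_mono mf.
have [mw intw] := inG_abs_wderiv Gf.
have mfun : measurable_fun [set: R] f by exact: continuous_measurable_fun.
have mabs : measurable_fun [set: R] (fun x => `|wderiv f x|).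
  exact: measurableT_comp.
rewrite [LHS]integral_mkcond [RHS]integral_mkcond.
have := @transfer_itvco R leb f (fun x => `|wderiv f x|) mfun mabs
  (fun=> normr_ge0 _).
move=> /(_ _ _ (t \_ `]f 0, (f 0 + 1)]))<-.
- apply: eq_integral => x _; rewrite /= !patchE !mem_setE !in_itv/=.
  by rewrite -[f 0 + 1]f1 add0r mf lf; case: ifP; rewrite ?mul0e.
- move=> c d; have [cd|dc] := ltP c d; first by rewrite lebesgue_itvco// ltry.
  by rewrite set_itv_ge ?measure0// bnd_simp -leNgt.
- move=> c d cd; rewrite lebesgue_itvco//.
  rewrite [X in integral _ X _](_ : _ = `[h c, h d[%classic); last first.
    apply/seteqP; split=> x /=; rewrite !in_itv/=.
      by rewrite -{1}(hf c) -{1}(hf d) mf lf.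
    by rewrite -{2}(hf c) -{2}(hf d) mf lf.
  rewrite integral_itvco_itvoc; last exact/measurable_EFinP.
  by rewrite intw ?hf// -lf !hf.
- exact/(measurable_restrictT _ _).1/measurable_funTS.
- by move=> x; rewrite patchE; case: ifP.
Qed.

End relabeling.

(** * Following a chain label by label *)

Section close.
Context {R : realType}.
Notation leb := (@lebesgue_measure R).
Implicit Types (f g psi nu : R -> R) (X Y Z : lagr R) (dl : R).

(** By continuity, a value above [dl] at a point of [[0, 1]] persists on an interval of positive
    measure inside [[0, 1]], against the essential bound. *)
Lemma normLoo_le f dl : continuous f -> (forall x, f (x + 1) = f x) ->
  (normLoo f <= dl%:E)%E -> forall x, `|f x| <= dl.
Proof.
move=> cf f1 fdl.
have muT : (0 < leb [set: measurableTypeR R])%E.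
  apply: (@lt_le_trans _ _ (leb `]0%R, 1%R])).
    by rewrite lebesgue_measure_itv/= lte_fin ltr01 sube0 lte_fin ltr01.
  apply: le_measure => //; rewrite inE; last exact: measurableT.
  exact: measurable_itv.
have f01 x : 0 <= x <= 1 -> `|f x| <= dl.
  move=> /andP[x0 x1]; rewrite leNgt; apply/negP => dlf.
  have [e /= e0 fe] : exists2 e : R, 0 < e & forall y, `|x - y| < e -> dl < `|f y|.
    have cn : `|f y| @[y --> x] --> `|f x| by apply: cvg_norm; exact: cf.
    have [e /= e0 be] := (nbhs_ballP _ _).1 (cvgr_gt _ cn _ dlf).
    by exists e => // y xy; apply: be.
  (* Clipping to [[0, 1]] keeps the interval inside the period, and it stays nondegenerate even when
     [x] is 0 or 1. *)
  pose a := Num.max 0 (x - e / 2); pose b := Num.min 1 (x + e / 2).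
  have ab : a < b.
    by rewrite /a /b gt_max !lt_min ltr01/=; apply/andP; split; lra.
  have : (\forall x \ae leb, `|((f \_ `[0%R, 1%R]) x)%:E| <= dl%:E)%E.
    move: fdl; rewrite /normLoo unlock muT => /ess_supP.
    by [].
  move=> [N [mN N0 sN]].
  have : (leb `]a, b] <= leb N)%E.
    apply: le_measure; rewrite ?inE; [exact: measurable_itv|exact: mN|].
    move=> y /=; rewrite in_itv/= /a /b gt_max le_min.
    move=> /andP[/andP[y0 xy] /andP[y1 yx]].
    apply: sN => /=; rewrite patchE mem_set/=; last by rewrite in_itv/= y1 ltW.
    apply/negP; rewrite -ltNge lte_fin; apply: fe; rewrite ltr_norml.
    by apply/andP; split; lra.
  by rewrite N0 lebesgue_measure_itv/= lte_fin ab lee_fin; lra.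
move=> x; rewrite -(periodicz f1 (- Num.floor x)); apply: f01.
have /andP[] := mem_rg1_floor x; rewrite mulrNz => fx xf.
by apply/andP; split; lra.
Qed.

(** The absolute value makes the integrand nonnegative for nonnegative [psi]; for elements of F it
    alters [nu] only on a null set. The period is half-open so that its translates tile the line. *)
Definition weighted_mass psi nu : \bar R :=
  (\int[leb]_(x in `]0%R, 1%R]) (psi x * `|nu x|)%:E)%E.

(* [k] maps the labels of [Y] to those of [X]. The last two inequalities bound
   the total variation of the difference of the two energies, transported by
   [k], over one period. *)
Definition close X Y dl := exists k : R -> R,
  [/\ measurable_fun [set: R] k, forall x, k (x + 1) = k x + 1 &
      forall z, exists x, k x = z] /\
  [/\ forall x, `|ly X (k x) - ly Y x| <= dl,
      forall x, `|lU X (k x) - lU Y x| <= dl &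
      forall psi C, measurable_fun [set: R] psi -> (forall x, 0 <= psi x <= C) ->
        (forall x, psi (x + 1) = psi x) ->
      (weighted_mass psi (lnu X) <= weighted_mass (psi \o k) (lnu Y) + (C * dl)%:E)%E /\
      (weighted_mass (psi \o k) (lnu Y) <= weighted_mass psi (lnu X) + (C * dl)%:E)%E].

Lemma close_refl X dl : 0 <= dl -> close X X dl.
Proof.
move=> dl0; exists id; split; split => //=; first by move=> z; exists z.
- by move=> x; rewrite subrr normr0.
- by move=> x; rewrite subrr normr0.
- move=> psi C _ psiC _; have /andP[p0 pC] := psiC 0.
  have C0 : 0 <= C by rewrite (le_trans p0).
  by split; rewrite leeDl// lee_fin mulr_ge0.
Qed.

(** The label maps are composed. The weight [psi \o k] is again periodic with the same bound [C], so
    the second closeness applies to it and the errors add. *)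
Lemma close_trans X Y Z d1 d2 : close X Y d1 -> close Y Z d2 -> close X Z (d1 + d2).
Proof.
move=> [k [[mk k1 ks] [ky kU kn]]] [l [[ml l1 ls] [lY lU' ln]]].
exists (k \o l); split; split.
- exact: measurableT_comp.
- by move=> x /=; rewrite l1 k1.
- by move=> z; have [y <-] := ks z; have [x <-] := ls y; exists x.
- move=> x /=; rewrite -(subrKA (ly Y (l x))).
  by rewrite (le_trans (ler_normD _ _))// lerD.
- move=> x /=; rewrite -(subrKA (lU Y (l x))).
  by rewrite (le_trans (ler_normD _ _))// lerD.
- move=> psi C mpsi psiC psi1.
  have [h1 h2] := kn _ _ mpsi psiC psi1.
  have [|x|x|h3 h4] := ln (psi \o k) C.
  + exact: measurableT_comp.
  + exact: psiC.
  + by rewrite /= k1 psi1.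
  rewrite mulrDr EFinD; split.
  + by rewrite (le_trans h1)// [((C * d1)%:E + _)%E]addeC addeA leeD2r.
  + by rewrite (le_trans h4)// addeA leeD2r.
Qed.

Lemma inG_inverse f : inG f -> exists h, [/\ cancel h f, cancel f h,
  measurable_fun [set: R] h & forall x, h (x + 1) = h x + 1].
Proof.
move=> Gf; have mf := inG_le Gf; have [[h fh hf] _ f1 _ _] := Gf.
exists h; split => //.
- apply: nondecreasing_measurable => // x y.
  by rewrite -{1}(hf x) -{1}(hf y) mf.
- by move=> x; rewrite -{1}(hf x) -f1 fh.
Qed.

(** Change of variables turns the relabeled mass into an integral over []f 0, f 0 + 1]], and
    periodicity moves this window back to []0, 1]]. *)
Lemma weighted_mass_relabel psi nu f : inG f ->
  measurable_fun [set: R] nu -> (\forall x \ae leb, nu (x + 1) = nu x) ->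
  measurable_fun [set: R] psi -> (forall x, 0 <= psi x) ->
  (forall x, psi (x + 1) = psi x) ->
  weighted_mass psi nu =
  weighted_mass (psi \o f) (fun x => nu (f x) * wderiv f x).
Proof.
move=> Gf mnu nu1 mpsi psi0 psi1.
have mt : measurable_fun [set: R] (fun x => (psi x * `|nu x|)%:E).
  by apply/measurable_EFinP; apply: measurable_funM => //; exact: measurableT_comp.
have t0 x : (0 <= (psi x * `|nu x|)%:E)%E by rewrite lee_fin mulr_ge0.
transitivity (\int[leb]_(x in `](f 0)%R, (f 0 + 1)%R]) (psi x * `|nu x|)%:E)%E.
  rewrite integral_ae_periodic//.
  by apply: (@filterS _ _ (ae_filter_ringOfSetsType leb) _ _ _ nu1) => x xnu;
    rewrite psi1 xnu.
rewrite -(inG_change_of_variables Gf mt t0); apply: eq_integral => x _ /=.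
by rewrite -EFinM normrM mulrA.
Qed.

Lemma le_weighted_mass psi (C : R) nu1 nu2 dl : 0 <= dl ->
  measurable_fun [set: R] psi -> (forall x, 0 <= psi x <= C) ->
  measurable_fun [set: R] nu1 -> measurable_fun [set: R] nu2 ->
  (normL1 (nu1 \- nu2)%R <= dl%:E)%E ->
  (weighted_mass psi nu1 <= weighted_mass psi nu2 + (C * dl)%:E)%E.
Proof.
move=> dl0 mpsi psiC mnu1 mnu2 nudl.
have C0 : 0 <= C by have /andP[p0 pC] := psiC 0; rewrite (le_trans p0).
have p0 x : 0 <= psi x by have /andP[] := psiC x.
have mn (nu : R -> R) : measurable_fun [set: R] nu ->
    measurable_fun [set: R] (fun x => psi x * `|nu x|).
  by move=> mnu; apply: measurable_funM => //; exact: measurableT_comp.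
have md : measurable_fun [set: R] (fun x => `|nu1 x - nu2 x|).
  by apply: measurableT_comp => //; exact: measurable_funB.
apply: (@le_trans _ _ (\int[leb]_(x in `]0%R, 1%R])
    ((psi x * `|nu2 x|)%:E + (C%:E * `|(nu1 x - nu2 x)%R|%:E)))%E).
  apply: ge0_le_integral => //.
  - by move=> x _; rewrite lee_fin mulr_ge0.
  - by apply/measurable_EFinP; apply: measurable_funTS; exact: mn.
  - apply: emeasurable_funD; apply/measurable_EFinP; apply: measurable_funTS.
      exact: mn.
    exact: measurable_funM.
  - move=> x _; rewrite -EFinM -EFinD lee_fin.
    have : `|nu1 x| <= `|nu2 x| + `|nu1 x - nu2 x|.
      by rewrite -{1}[nu1 x](subrK (nu2 x)) addrC ler_normD.
    move=> /(ler_wpM2l (p0 x))/le_trans; apply; rewrite mulrDr lerD2l ler_wpM2r//.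
    by have /andP[] := psiC x.
rewrite ge0_integralD//; last 4 first.
- by move=> x _; rewrite lee_fin mulr_ge0.
- by apply/measurable_EFinP; apply: measurable_funTS; exact: mn.
- by move=> x _; rewrite -EFinM lee_fin mulr_ge0.
- by apply/measurable_EFinP; apply: measurable_funTS; exact: measurable_funM.
apply: leeD => //; rewrite ge0_integralZl_EFin//; last first.
  by apply/measurable_EFinP; exact: measurable_funTS.
rewrite EFinM lee_wpmul2l ?lee_fin//; apply: le_trans nudl.
rewrite /normL1 integral_itv_obnd_cbnd//.
by apply/measurable_EFinP; exact: measurable_funTS.
Qed.

Lemma normL1_ge0 f : (0 <= normL1 f)%E.
Proof. by apply: integral_ge0 => x _; rewrite lee_fin. Qed.

Lemma normV_ge0 f : (0 <= normV f)%E.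
Proof. by apply: adde_ge0; [exact: Lnorm_ge0|exact: normL1_ge0]. Qed.

Lemma normE_ge0 X : (0 <= normE X)%E.
Proof. exact: (adde_ge0 (adde_ge0 (normV_ge0 _) (normV_ge0 _)) (normL1_ge0 _)). Qed.

Lemma normE_le X dl : (normE X <= dl%:E)%E ->
  [/\ (normLoo (ly X) <= dl%:E)%E, (normLoo (lU X) <= dl%:E)%E &
      (normL1 (lnu X) <= dl%:E)%E].
Proof.
have Loo_le f : (normLoo f <= normV f)%E by rewrite leeDl// normL1_ge0.
move=> XE; split; apply: le_trans XE; rewrite /normE.
- rewrite (le_trans (Loo_le _))// -addeA leeDl//.
  exact: (adde_ge0 (normV_ge0 _) (normL1_ge0 _)).
- rewrite (le_trans (Loo_le _))// addeAC leeDr//.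
  exact: (adde_ge0 (normV_ge0 _) (normL1_ge0 _)).
- by rewrite leeDr//; exact: (adde_ge0 (normV_ge0 _) (normV_ge0 _)).
Qed.

(** The label map is [f] after the inverse of [g]. Relabeling by [f] and by [g] brings both masses
    to common labels, where the weights coincide because [psi \o k \o g = psi \o f]; only the L1
    distance of the relabeled energies is left. *)
Lemma close_of_relabel X Y f g dl : inF X -> inF Y -> inG f -> inG g ->
  (normE (lagr_sub (relabel X f) (relabel Y g)) <= dl%:E)%E -> close X Y dl.
Proof.
move=> FX FY Gf Gg fgdl.
have dl0 : 0 <= dl by rewrite -lee_fin (le_trans _ fgdl)// normE_ge0.
have [/= yfg Ufg nufg] := normE_le fgdl.
have [h [hg gh mh h1]] := inG_inverse Gg.
have [e [he eh _ _]] := inG_inverse Gf.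
have [_ [[cf wf] _] f1 _ _] := Gf; have [_ [[cg wg] _] g1 _ _] := Gg.
have [[[_ [[cUX _] UX1] [[mnuX _ _] nuX1]] [[cyX _] yX1] _ _] _] := FX.
have [[[_ [[cUY _] UY1] [[mnuY _ _] nuY1]] [[cyY _] yY1] _ _] _] := FY.
have [mwf _] := inG_abs_wderiv Gf; have [mwg _] := inG_abs_wderiv Gg.
have mf : measurable_fun [set: R] f by exact: continuous_measurable_fun.
have mg : measurable_fun [set: R] g by exact: continuous_measurable_fun.
have contB (u v : R -> R) : continuous u -> continuous v ->
    continuous ((u \o f) \- (v \o g)).
  move=> cu cv x; apply: cvgB; apply: continuous_comp;
    [exact: cf|exact: cu|exact: cg|exact: cv].
have yle := normLoo_le (contB _ _ cyX cyY) _ yfg.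
have Ule := normLoo_le (contB _ _ cUX cUY) _ Ufg.
exists (f \o h); split; split.
- exact: measurableT_comp.
- by move=> x /=; rewrite h1 f1.
- by move=> z; exists (g (e z)); rewrite /= gh he.
- move=> x; rewrite -{2}(hg x) /=; apply: yle => z.
  by rewrite /= f1 g1 yX1 yY1; lra.
- move=> x; rewrite -{2}(hg x) /=; apply: Ule => z.
  by rewrite /= f1 g1 UX1 UY1.
- move=> psi C mpsi psiC psi1.
  have p0 x : 0 <= psi x by have /andP[] := psiC x.
  rewrite (weighted_mass_relabel Gf mnuX nuX1 mpsi p0 psi1).
  rewrite (@weighted_mass_relabel (psi \o (f \o h)) _ _ Gg mnuY nuY1); last 3 first.
  + by apply: measurableT_comp => //; exact: measurableT_comp.
  + by move=> x; exact: p0.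
  + by move=> x; rewrite /= h1 f1 psi1.
  have -> : (psi \o (f \o h)) \o g = psi \o f by apply/funext => x /=; rewrite gh.
  have mnf : measurable_fun [set: R] (fun x => lnu X (f x) * wderiv f x).
    by apply: measurable_funM => //; exact: measurableT_comp.
  have mng : measurable_fun [set: R] (fun x => lnu Y (g x) * wderiv g x).
    by apply: measurable_funM => //; exact: measurableT_comp.
  have mpf : measurable_fun [set: R] (psi \o f) by exact: measurableT_comp.
  have pC x : 0 <= (psi \o f) x <= C by exact: psiC.
  split; first exact: (le_weighted_mass dl0 mpf pC mnf mng nufg).
  apply: (le_weighted_mass dl0 mpf pC mng mnf).
  apply: le_trans nufg; rewrite le_eqVlt; apply/orP; left; apply/eqP.
  by apply: eq_integral => x _; rewrite /= distrC.
Qed.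

Lemma J_ge0 X Y : (0 <= J X Y)%E.
Proof. by apply: le_ereal_inf_tmp => _ [f [g [_ _ ->]]]; exact: normE_ge0. Qed.

Lemma close_of_J X Y dl : inF X -> inF Y -> (J X Y < dl%:E)%E -> close X Y dl.
Proof.
move=> FX FY /ereal_inf_lt[_ [f [g [Gf Gg ->]]] /ltW].
exact: close_of_relabel.
Qed.

Lemma close_of_chain (Z : nat -> lagr R) (N : nat) dl :
  (forall n, (n <= N)%N -> inF (Z n)) ->
  (\sum_(1 <= n < N.+1) J (Z n.-1) (Z n) < dl%:E)%E -> close (Z 0) (Z N) dl.
Proof.
elim: N dl => [|N IH] dl FZ.
  by rewrite big_geq// lte_fin => /ltW; exact: close_refl.
rewrite big_nat_recr//=; set S := (\sum_(1 <= _ < _) _)%E => SJ.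
have S0 : (0 <= S)%E by apply: sume_ge0 => n _; exact: J_ge0.
have J0 := J_ge0 (Z N) (Z N.+1).
have Sfin : S \is a fin_num.
  by rewrite ge0_fin_numE// (le_lt_trans _ (lt_trans SJ (ltry _)))// leeDl.
have Jfin : J (Z N) (Z N.+1) \is a fin_num.
  by rewrite ge0_fin_numE// (le_lt_trans _ (lt_trans SJ (ltry _)))// leeDr.
move: SJ; rewrite -(fineK Sfin) -(fineK Jfin) -EFinD lte_fin => sj.
set s := fine S in sj; set j := fine _ in sj.
(* The strict inequality leaves the slack [dl - s - j]; each part receives half of it, so that both
   bounds stay strict. *)
have -> : dl = (s + (dl - s - j) / 2) + (j + (dl - s - j) / 2) by lra.
apply: close_trans.
  apply: IH; first by move=> n nN; exact/FZ/leqW.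
  by rewrite -/S -(fineK Sfin) lte_fin -/s; lra.
apply: close_of_J; [exact/FZ|exact: FZ|].
by rewrite -(fineK Jfin) lte_fin -/j; lra.
Qed.

(** Membership of the end points in F is read off the chain; for images of Eulerian pairs it is
    obtained in this way below. *)
Lemma close_of_d X Y dl : (d X Y < dl%:E)%E -> [/\ inF X, inF Y & close X Y dl].
Proof.
move=> /ereal_inf_lt[_ [N [Z [FZ Z0 ZN ->]]] sN].
split; [by rewrite -Z0; exact: FZ|by rewrite -ZN; exact: FZ|].
by rewrite -Z0 -ZN; exact: close_of_chain sN.
Qed.

End close.

(** * The Lagrangian image of an Eulerian pair *)

Section identity_relabeling.
Context {R : realType}.
Notation leb := (@lebesgue_measure R).

Lemma locally_integrable_cst (c : R) : locally_integrable [set: R] (cst c).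
Proof.
split; [exact: measurable_cst|exact: openT|move=> K _ cK].
apply: (le_lt_trans _ (_ : `|c|%:E * leb K < +oo)%E); last first.
  by rewrite lte_mul_pinfty ?lee_fin//; exact: compact_finite_measure.
by rewrite le_eqVlt; apply/orP; left; apply/eqP;
  apply: (integral_cst leb (compact_measurable cK) `|c|%:E).
Qed.

Lemma weak_derivative_id : weak_derivative (id : R -> R) (wderiv id).
Proof.
by apply: wderivP; apply: (@lipschitz_weak_derivative R id 1) => // x y _;
  rewrite mul1r.
Qed.

(** [wderiv] is a chosen representative, so even for the identity its value is known only almost
    everywhere. Its difference with 1 has integral zero over every interval. *)
Lemma wderiv_id : \forall x \ae leb, wderiv (id : R -> R) x = 1.
Proof.
have wd := weak_derivative_id; have [lw _] := wd.
have cid : continuous (id : R -> R) by move=> x; exact: cvg_id.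
have ftc := weak_derivative_primitive cid wd.
have l1 := locally_integrable_cst 1.
have le1 : \forall x \ae leb, 0 <= cst 1 x - wderiv id x.
  apply: ae_ge0_of_integral_ge0; first exact: locally_integrableB.
  move=> a b ab; rewrite RintegralB//.
  - by rewrite ftc// Rintegral_itvoc_cst// mul1r subrr.
  - exact: locally_integrable_itv.
  - exact: locally_integrable_itv.
have ge1 : \forall x \ae leb, 0 <= wderiv id x - cst 1 x.
  apply: ae_ge0_of_integral_ge0; first exact: locally_integrableB.
  move=> a b ab; rewrite RintegralB//.
  - by rewrite ftc// Rintegral_itvoc_cst// mul1r subrr.
  - exact: locally_integrable_itv.
  - exact: locally_integrable_itv.
apply: (@filterS2 _ _ (ae_filter_ringOfSetsType leb) _ _ _ _ le1 ge1) => x /=.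
by move=> ? ?; lra.
Qed.

Lemma inverse_fun_id : inverse_fun (id : R -> R) = id.
Proof.
apply/funext => x; rewrite /inverse_fun.
by have := @pinvK R R (cst 0) [set: R] id x; apply; rewrite inE; exists x.
Qed.

End identity_relabeling.

(** * The quantile map of an Eulerian measure and the energy it carries *)

Section eulerian_quantile.
Context {R : realType}.
Notation leb := (@lebesgue_measure R).
Variable mu : {measure set (measurableTypeR R) -> \bar R}.
Hypothesis rmu : radon mu.
Implicit Types (a b x y z t : R).

Let mitv a b := fine (mu `[a, b[%classic).

Lemma radon_itvco_fin a b : mu `[a, b[%classic \is a fin_num.
Proof.
rewrite ge0_fin_numE//; apply: (le_lt_trans _ (rmu (@segment_compact _ a b))).
apply: le_measure; rewrite ?inE; [exact: measurable_itv..|].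
by apply: subset_itvl; rewrite bnd_simp.
Qed.

Let mitv_ge0 a b : 0 <= mitv a b.
Proof. by rewrite fine_ge0. Qed.

Let mitvU a b z : a <= b -> b <= z -> mitv a z = mitv a b + mitv b z.
Proof.
move=> ab bz; rewrite /mitv -fineD ?radon_itvco_fin// -measureU//.
- congr (fine (mu _)); apply/seteqP; split=> x /=; rewrite !in_itv/=;
    [case: (ltP x b); lra|lra].
- by apply/seteqP; split=> x //= []; rewrite !in_itv/=; lra.
Qed.

Let mitv0 a b : b <= a -> mitv a b = 0.
Proof. by move=> ba; rewrite /mitv set_itv_ge ?measure0// bnd_simp -leNgt. Qed.

Lemma FmuB a b : a <= b -> Fmu mu b - Fmu mu a = mitv a b.
Proof.
move=> ab; rewrite /Fmu -!/(mitv _ _); case: (leP 0 b) => b0; case: (leP 0 a) => a0.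
- by rewrite (mitvU a0 ab) addrAC subrr add0r.
- by rewrite opprK addrC -mitvU// ltW.
- by lra.
- by rewrite opprK addrC (mitvU ab (ltW b0)) addrK.
Qed.

(** The function whose generalized inverse defines the Lagrangian position. It has slope at least
    one and jumps at the atoms of [mu]. *)
Let G z := Fmu mu z + z.

Let ltG a b : a <= b -> b - a <= G b - G a.
Proof. by move=> ab; have := FmuB ab; have := mitv_ge0 a b; rewrite /G; lra. Qed.

Let leG a b : (G a <= G b) = (a <= b).
Proof.
have [ab|ba] := leP a b; first by have := ltG ab; lra.
by have := ltG (ltW ba); apply: contraTF => ?; lra.
Qed.

Let G0 : G 0 = 0.
Proof. by rewrite /G /Fmu lexx -/(mitv 0 0) mitv0// addr0. Qed.

(** Left continuity in the form used for suprema: the mass of [[y - 1/(n+1), y[] tends to zero,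
    because these sets decrease to the empty set. *)
Let G_left_cont y t : (forall z, z < y -> G z <= t) -> G y <= t.
Proof.
move=> Gt; pose e n : R := n.+1%:R^-1.
have cvgm : mitv (y - e n) y @[n --> \oo] --> 0.
  have := @nonincreasing_cvg_mu _ _ _ mu (fun n => `[y - e n, y[%classic).
  have -> : \bigcap_n `[y - e n, y[%classic = set0 :> set R.
    apply/seteqP; split=> // x /= xy.
    have xy0 : x < y by have := xy 0%N I; rewrite /= in_itv/= => /andP[].
    have [n yxn] : exists n, e n < y - x.
      have yx : 0 < y - x by lra.
      have [n _] := near_infty_natSinv_lt (PosNum yx).
      by move=> /(_ n (leqnn n)); exists n.
    by have := xy n I; rewrite /= in_itv/=; lra.
  rewrite measure0 => h; apply: fine_cvg; apply: h => //.
  - by rewrite -ge0_fin_numE// radon_itvco_fin.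
  - move=> m n mn; apply/subsetPset; apply: subset_itvr; rewrite bnd_simp lerB//.
    by rewrite lef_pV2 ?posrE// ler_nat.
have cvge : G y - (mitv (y - e n) y + e n) @[n --> \oo] --> G y.
  rewrite -[X in _ --> X]subr0 -[X in _ - X](addr0 0).
  by apply: cvgB; [exact: cvg_cst|apply: cvgD => //; exact: cvg_harmonic].
rewrite -(cvg_lim _ cvge)//; apply: limr_le; first by apply/cvg_ex; exists (G y).
apply: nearW => n; have e0 : 0 < e n by rewrite invr_gt0.
have yn : y - e n <= y by lra.
by have := Gt (y - e n); have := FmuB yn; rewrite /G; lra.
Qed.

Let Q t := sup [set z | G z < t].

Let has_supG t : has_sup [set z | G z < t].
Proof.
split.
  exists (Num.min (t - 1) 0) => /=; set z := Num.min _ _.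
  have z0 : z <= 0 by rewrite ge_min lexx orbT.
  have zt : z <= t - 1 by rewrite ge_min lexx.
  by have := ltG z0; rewrite G0; lra.
exists (Num.max t 0) => z /= zt; have [z0|z0] := leP z 0.
  by rewrite le_max z0 orbT.
by have := ltG (ltW z0); rewrite G0 le_max => ?; apply/orP; left; lra.
Qed.

(** The Galois connection between [G] and its generalized inverse. Left continuity of [G] at the
    supremum gives one direction; strict monotonicity, tested at the midpoint of [Q t] and [b],
    gives the other. *)
Let leQ b t : (b <= Q t) = (G b <= t).
Proof.
apply/idP/idP => [bQ|Gt].
  apply: (@le_trans _ _ (G (Q t))); first by rewrite leG.
  apply: G_left_cont => z zQ.
  have Qz : 0 < Q t - z by lra.
  have [x /= Gx zx] := sup_adherent Qz (has_supG t).
  by rewrite (le_trans _ (ltW Gx))// leG ltW//; move: zx; rewrite subKr.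
rewrite leNgt; apply/negP => Qb; pose z := (Q t + b) / 2.
have zb : z < b by rewrite /z; lra.
have : z <= Q t.
  apply: sup_upper_bound; first exact: has_supG.
  by rewrite /= (lt_le_trans _ Gt)// ltNge leG -ltNge.
by rewrite /z; lra.
Qed.

Let QG b : Q (G b) = b.
Proof. by apply/eqP; rewrite eq_le leQ lexx andbT -leG -leQ. Qed.

(** Since [G] has slope at least one, its generalized inverse has slope at most one. *)
Let Q_lip t t' : t <= t' -> 0 <= Q t' - Q t <= t' - t.
Proof.
move=> tt'; have QQ : Q t <= Q t' by rewrite leQ (le_trans _ tt')// -leQ.
rewrite subr_ge0 QQ/= lerBlDr -lerBlDl leQ.
have : G (Q t') <= t' by rewrite -leQ.
have le : Q t' - (t' - t) <= Q t' by lra.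
by have := ltG le; lra.
Qed.

Let h := mitv 0 1.
Let c := 1 + h.
Let c0 : 0 < c. Proof. by rewrite ltr_pwDl ?mitv_ge0. Qed.

Let y x := Q (c * x).

Let y_lip a b : a <= b -> 0 <= y b - y a <= c * (b - a).
Proof. by move=> ab; rewrite mulrBr; apply: Q_lip; rewrite ler_pM2l. Qed.

Let y0 : y 0 = 0. Proof. by rewrite /y mulr0 -G0 QG. Qed.

Let y1 : y 1 = 1.
Proof.
have G1 : G 1 = c by rewrite /G /Fmu ler01 addrC.
by rewrite /y mulr1 -G1 QG.
Qed.

Let y_nd : {homo y : a b / a <= b}.
Proof. by move=> a b /y_lip/andP[]; rewrite subr_ge0. Qed.

Let cy : continuous y.
Proof.
apply: (lipschitz_continuous (ltW c0)) => a b ab.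
by have /andP[yab yc] := y_lip ab; rewrite ger0_norm.
Qed.

Let weak_y : weak_derivative y (wderiv y).
Proof.
apply: wderivP; apply: (lipschitz_weak_derivative (ltW c0) y_nd) => a b ab.
by have /andP[] := y_lip ab.
Qed.

Let nu0 x := c - wderiv y x.

Let lnu0 : locally_integrable [set: R] nu0.
Proof.
have [lw _] := weak_y; exact: (locally_integrableB (locally_integrable_cst c) lw).
Qed.

Let int_nu0 a b : a < b ->
  \int[leb]_(x in `]a, b]) nu0 x = c * (b - a) - (y b - y a).
Proof.
move=> ab; have [lw _] := weak_y; rewrite RintegralB//.
- by rewrite Rintegral_itvoc_cst// (weak_derivative_primitive cy weak_y).
- exact: (locally_integrable_itv _ _ _ _ (locally_integrable_cst c)).
- exact: locally_integrable_itv.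
Qed.

Let abs_nu0 a b : a < b ->
  (\int[leb]_(x in `]a, b]) `|nu0 x|%:E = (c * (b - a) - (y b - y a))%:E)%E.
Proof.
move=> ab; have ae0 : \forall x \ae leb, 0 <= nu0 x.
  apply: ae_ge0_of_integral_ge0 => // a' b' ab'; rewrite int_nu0//.
  by have /andP[_ ?] := y_lip (ltW ab'); lra.
have [mnu _ _] := lnu0.
have inu : leb.-integrable `]a, b] (EFin \o nu0) by exact: locally_integrable_itv.
rewrite -int_nu0// /Rintegral fineK; last exact: integrable_fin_num.
apply: ae_eq_integral => //.
- by apply/measurable_EFinP; apply: measurable_funTS; exact: measurableT_comp.
- by apply/measurable_EFinP; apply: measurable_funTS.
- apply: (@filterS _ _ (ae_filter_ringOfSetsType leb) _ _ _ ae0) => x x0 _ /=.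
  by rewrite ger0_norm.
Qed.

Let mabs : measurable_fun [set: R] (fun x => `|nu0 x|).
Proof. by have [mnu _ _] := lnu0; exact: measurableT_comp. Qed.

Let lh_nu0 : fine (normL1 nu0) = h.
Proof.
rewrite /normL1 -integral_itv_obnd_cbnd.
  by rewrite abs_nu0// y0 y1 /c /=; lra.
by apply/measurable_EFinP; apply: measurable_funTS.
Qed.

(** Adding [y x] leaves [c * x]; after division by [1 + h] the map inverted in [Pi1] is the
    identity. *)
Let oriented_nu0 x : oriented_integral nu0 0 x = c * x - y x.
Proof.
have int_cl a b : a < b -> \int[leb]_(z in `[a, b]) nu0 z = c * (b - a) - (y b - y a).
  move=> ab; rewrite -Rintegral_itv_obnd_cbnd ?int_nu0//.
  exact: locally_integrable_itv.
rewrite /oriented_integral; case: (ltgtP 0 x) => [x0|x0|<-].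
- by rewrite int_cl// y0; lra.
- by rewrite int_cl// y0; lra.
- by rewrite set_itv1 Rintegral_set1 y0; lra.
Qed.

Let pushforward_nu0 (t : R -> \bar R) : measurable_fun [set: R] t ->
  (forall x, (0 <= t x)%E) ->
  (\int[leb]_x (t (y x) * `|nu0 x|%:E) = \int[mu]_x t x)%E.
Proof.
move=> mt t0.
have my : measurable_fun [set: R] y by exact: continuous_measurable_fun.
apply: (transfer_itvco my mabs (fun=> normr_ge0 _)) => // [a b|a b ab].
  by rewrite -ge0_fin_numE// radon_itvco_fin.
(* The Galois connection describes the preimage of [[a, b[] exactly, also when [G] jumps at [a] or
   [b]. *)
rewrite [X in integral _ X _](_ : _ = `[G a / c, G b / c[%classic); last first.
  apply/predeqP => x /=; rewrite !in_itv/= ler_pdivrMr// ltr_pdivlMr//.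
  by rewrite /y [Q _ < b]ltNge !leQ -ltNge [x * c]mulrC.
rewrite integral_itvco_itvoc; last exact/measurable_EFinP.
rewrite abs_nu0; last by rewrite ltr_pM2r ?invr_gt0// ltNge leG -ltNge.
have yG z : y (G z / c) = z.
  by rewrite /y [c * _]mulrC divfK ?QG// gt_eqF.
rewrite !yG -mulrBl mulrCA divff ?mulr1 ?gt_eqF//.
rewrite -[RHS]fineK ?radon_itvco_fin// -/(mitv a b) -FmuB ?ltW// /G.
by congr EFin; lra.
Qed.

(** [Pi1] relabels by the identity and [Pi2] translates the labels, which leaves integrals over the
    whole line unchanged. The remaining factor [wderiv id] is 1 almost everywhere. *)
Lemma energy_Lmap (u : R -> R) (t : R -> \bar R) : measurable_fun [set: R] t ->
  (forall x, (0 <= t x)%E) ->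
  (\int[leb]_x (t (ly (Lmap u mu) x) * `|lnu (Lmap u mu) x|%:E) =
   \int[mu]_x t x)%E.
Proof.
move=> mt t0; rewrite -pushforward_nu0//.
rewrite /Lmap /Pi -/h -/c -/y.
have -> : Pi1 (Lagr y (u \o y) (fun xi => c - wderiv y xi)) =
    relabel (Lagr y (u \o y) nu0) id.
  rewrite /Pi1 /= -[RHS]/(relabel (Lagr y (u \o y) nu0) id) -inverse_fun_id.
  congr (relabel _ (inverse_fun _)); apply/funext => x.
  by rewrite /lh lh_nu0 oriented_nu0 addrCA subrr addr0 mulKf// gt_eqF.
rewrite /Pi2 /relabel /=; set a := Rintegral _ _ _.
have [[mw _ _] _] := @weak_derivative_id R.
have [mnu _ _] := lnu0.
have my : measurable_fun [set: R] y by exact: continuous_measurable_fun.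
have mty : measurable_fun [set: R] (t \o y) by exact: measurableT_comp.
pose F z := (t (y z) * `|nu0 z * wderiv id z|%:E)%E.
have mF : measurable_fun [set: R] F.
  apply: emeasurable_funM => //; apply/measurable_EFinP.
  by apply: measurableT_comp => //; exact: measurable_funM.
have F0 z : (0 <= F z)%E by rewrite mule_ge0.
transitivity (\int[leb]_x F (x - a)%R)%E; first by [].
rewrite (ge0_integral_shift (- a) mF F0); apply: ge0_ae_eq_integral => //.
- by apply: emeasurable_funM => //; exact/measurable_EFinP.
- by move=> z _; rewrite mule_ge0.
- apply: (@filterS _ _ (ae_filter_ringOfSetsType leb) _ _ _ (@wderiv_id R)) => z z1 _.
  by rewrite /F z1 mulr1.
Qed.

End eulerian_quantile.

(** * Periodization of test functions *)

Section periodic_functions.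
Context {R : realType}.
Implicit Types (f phi : R -> R) (x z : R).

Lemma floor_shift x : exists n : int, 0 <= x + n%:~R <= 1.
Proof.
exists (- Num.floor x); have /andP[fx xf] := mem_rg1_floor x.
by rewrite mulrNz; apply/andP; split; lra.
Qed.

Lemma periodic_bounded f : continuous f -> (forall x, f (x + 1) = f x) ->
  exists2 B, 0 <= B & forall x, `|f x| <= B.
Proof.
move=> cf f1; have [c _ cmax] : exists2 c, c \in `[0, 1] &
    forall t, t \in `[0, 1] -> `|f t| <= `|f c|.
  apply: EVT_max; first exact: ler01.
  by apply: continuous_subspaceT => x; apply: cvg_norm; exact: cf.
exists `|f c| => // x; have [n x01] := floor_shift x.
by rewrite -(periodicz f1 n); apply: cmax; rewrite in_itv.
Qed.

(** Compactness of [[0, 1]] is used only for [x], while [z] ranges over the line; an integer shift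
    of both points reduces to this case. *)
Lemma periodic_uniformly_continuous f : continuous f ->
  (forall x, f (x + 1) = f x) ->
  forall e, 0 < e -> exists2 dl, 0 < dl &
    forall x z, `|x - z| <= dl -> `|f x - f z| <= e.
Proof.
move=> cf f1 e e0.
have /compact_near_coveringP cover := @segment_compact R 0 1.
have := cover R 0^'+ (fun dl x => forall z, `|x - z| <= dl -> `|f x - f z| <= e) _.
case.
  move=> x _; have e2 : 0 < e / 2 by lra.
  have /cvgrPdist_le/(_ _ e2)/nbhs_ballP[r /= r0 fr] := cf x.
  have r2 : 0 < r / 2 by lra.
  exists (ball x (r / 2), [set dl | dl < r / 2]).
    split; first exact: nbhsx_ballx.
    exact: nbhs_right_lt.
  move=> [x' dl] /= [xx' dlr] z x'z.
  have xz : `|x - z| < r.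
    rewrite -(subrKA x') (le_lt_trans (ler_normD _ _))//.
    by move: xx'; rewrite /ball/= => xx'; lra.
  have h1 := fr z xz.
  have h2 : `|f x - f x'| <= e / 2.
    by apply: fr; rewrite /ball/= (lt_trans xx')//; lra.
  rewrite -(subrKA (f x)) (le_trans (ler_normD _ _))// distrC; lra.
move=> dl0 /= dl0_gt0 H.
have d2 : 0 < dl0 / 2 by lra.
exists (dl0 / 2) => // x z xz; have [n x01] := floor_shift x.
rewrite -(periodicz f1 n x) -(periodicz f1 n z); apply: (H (dl0 / 2)) => //.
- by rewrite /= sub0r normrN gtr0_norm//; lra.
- by rewrite opprD addrACA subrr addr0.
Qed.

Lemma quasiperiodic_surjective f : continuous f ->
  (forall x, f (x + 1) = f x + 1) -> forall z, exists x, f x = z.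
Proof.
move=> cf f1 z; have fz := quasiperiodicz f1.
(* This [n] places [z] between [f n] and [f (n + 1)], ready for the intermediate value theorem. *)
pose n := Num.floor (z - f 0).
have /andP[nz zn] := mem_rg1_floor (z - f 0).
have fn : f n%:~R = f 0 + n%:~R by rewrite -[n%:~R]add0r fz mul1r add0r.
have fn1 : f (n%:~R + 1) = f 0 + n%:~R + 1 by rewrite f1 fn.
have [|||c _ <-] := @IVT R f n%:~R (n%:~R + 1) z; last by exists c.
- by lra.
- exact: continuous_subspaceT.
- move: nz zn; rewrite fn fn1 ge_min le_max -/n => nz zn.
  by apply/andP; split; apply/orP; [left|right]; lra.
Qed.

Lemma exists_nat_ge x : exists n : nat, x <= n%:R.
Proof.
exists (Num.truncn `|x|).+1.
by rewrite (le_trans (ler_norm x))// ltW// truncnS_gt.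
Qed.

Section periodization.
Variables (phi : R -> R) (M : R).
Hypotheses (cphi : continuous phi) (phi0 : forall x, 0 <= phi x).
Hypothesis phiM : forall x, M < `|x| -> phi x = 0.

(** Every integer shift from [-K] to [K - 1] occurs once, matching the unit cells of []-K, K]]. *)
Definition shift_sum (K : nat) x :=
  \sum_(k < K) (phi (x + k%:R) + phi (x - k.+1%:R)).

(** The truncation depends on [x]: once [|x| + |M| + 1 <= K], further shifts leave the support of
    [phi] and the sum no longer depends on [K]. *)
Definition periodization x := shift_sum (Num.truncn (`|x| + `|M| + 1)).+1 x.

Let shift_sum_stable (K : nat) x : `|x| + `|M| + 1 <= K%:R ->
  shift_sum K.+1 x = shift_sum K x.
Proof.
move=> xK; have [xx xN MM] := And3 (ler_norm x) (ler_norm (- x)) (ler_norm M).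
rewrite normrN in xN.
rewrite /shift_sum big_ord_recr/= (phiM (x := x + K%:R)) ?(phiM (x := x - K.+1%:R)).
- by rewrite !addr0.
- by rewrite ltr_normr -natr1; apply/orP; right; lra.
- by rewrite ltr_normr; apply/orP; left; lra.
Qed.

Lemma periodizationE (K : nat) x : `|x| + `|M| + 1 <= K%:R ->
  periodization x = shift_sum K x.
Proof.
have stable (m : nat) k : `|x| + `|M| + 1 <= m%:R ->
    shift_sum (m + k) x = shift_sum m x.
  move=> xm; elim: k => [|k IH]; first by rewrite addn0.
  by rewrite addnS shift_sum_stable// (le_trans xm)// ler_nat leq_addr.
set K0 := (Num.truncn (`|x| + `|M| + 1)).+1 => xK.
have xK0 : `|x| + `|M| + 1 <= K0%:R by rewrite ltW// truncnS_gt.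
by rewrite /periodization -/K0 -(stable K0 K xK0) -(stable K K0 xK) addnC.
Qed.

(** Telescoping: a unit translation moves the window of shifts by one, so only the two extreme terms
    change. *)
Let shift_sumD1 K x : shift_sum K (x + 1) + phi (x - K%:R) =
  shift_sum K x + phi (x + K%:R).
Proof.
elim: K => [|K IH]; first by rewrite /shift_sum !big_ord0 subr0 addr0.
rewrite /shift_sum !big_ord_recr/= -!/(shift_sum _ _).
have -> : x + 1 - K.+1%:R = x - K%:R by rewrite -natr1; lra.
have -> : x + 1 + K%:R = x + K.+1%:R by rewrite -natr1; lra.
lra.
Qed.

Lemma periodization_periodic x : periodization (x + 1) = periodization x.
Proof.
have [K xK] := exists_nat_ge (`|x| + `|M| + 2).
have x1 : `|x + 1| <= `|x| + 1 by rewrite (le_trans (ler_normD _ _))// normr1.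
rewrite (@periodizationE K); last by lra.
rewrite (@periodizationE K x); last by lra.
have := shift_sumD1 K x.
have [xx xN MM] := And3 (ler_norm x) (ler_norm (- x)) (ler_norm M).
rewrite normrN in xN.
rewrite (phiM (x := x - K%:R)) ?(phiM (x := x + K%:R)) ?addr0//.
- by rewrite ltr_normr; apply/orP; left; lra.
- by rewrite ltr_normr; apply/orP; right; lra.
Qed.

Lemma periodization_ge0 x : 0 <= periodization x.
Proof. by apply: sumr_ge0 => k _; rewrite addr_ge0. Qed.

Let continuous_shift_sum K : continuous (shift_sum K).
Proof.
elim: K => [|K IH] x.
  have -> : shift_sum 0 = cst 0 by apply/funext => z; rewrite /shift_sum big_ord0.
  exact: cvg_cst.
have -> : shift_sum K.+1 =
    (fun z => shift_sum K z + (phi (z + K%:R) + phi (z - K.+1%:R))).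
  by apply/funext => z; rewrite /shift_sum big_ord_recr.
apply: cvgD; [exact: IH|apply: cvgD].
- apply: (@continuous_comp _ _ _ (fun z => z + K%:R) phi); last exact: cphi.
  by apply: cvgD; [exact: cvg_id|exact: cvg_cst].
- apply: (@continuous_comp _ _ _ (fun z => z - K.+1%:R) phi); last exact: cphi.
  by apply: cvgB; [exact: cvg_id|exact: cvg_cst].
Qed.

(** Within distance 1 of [x] a single [K] serves for all points, so the function is locally a finite
    sum of continuous ones. *)
Lemma continuous_periodization : continuous periodization.
Proof.
move=> x; have [K xK] := exists_nat_ge (`|x| + 1 + `|M| + 1).
have near_x : \forall z \near x, shift_sum K z = periodization z.
  near=> z; rewrite (@periodizationE K)//.
  suff : `|z| <= `|x| + 1 by lra.
  have zx : `|x - z| <= 1.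
    by near: z; apply: cvgr_dist_le; [exact: cvg_id|exact: ltr01].
  by rewrite -[z](subrK x) (le_trans (ler_normD _ _))// addrC lerD2l distrC.
rewrite /continuous_at -(nbhs_singleton near_x).
apply: cvg_trans (near_eq_cvg near_x) _.
exact: continuous_shift_sum.
Unshelve. all: by end_near. Qed.

End periodization.
End periodic_functions.

(** * Reduction of energy integrals over the line to one period *)

Section energy_over_a_period.
Context {R : realType}.
Notation leb := (@lebesgue_measure R).
Variables (y nu : R -> R).
Hypotheses (cy : continuous y) (y1 : forall x, y (x + 1) = y x + 1).
Hypotheses (mnu : measurable_fun [set: R] nu).
Hypothesis nu1 : \forall x \ae leb, nu (x + 1) = nu x.

Let my : measurable_fun [set: R] y. Proof. exact: continuous_measurable_fun. Qed.

Let mprod (phi : R -> R) : measurable_fun [set: R] phi ->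
  measurable_fun [set: R] (fun x => (phi (y x) * `|nu x|)%:E).
Proof.
move=> mphi; apply/measurable_EFinP; apply: measurable_funM.
  exact: (measurableT_comp mphi my).
exact: measurableT_comp.
Qed.

(** One unit of translation in the label becomes one unit in [y], which is absorbed into the test
    function; hence the induction is generalized over [phi]. *)
Let integral_shift (phi : R -> R) (k : nat) (a b : R) :
  measurable_fun [set: R] phi -> (forall x, 0 <= phi x) ->
  (\int[leb]_(x in `](a + k%:R)%R, (b + k%:R)%R]) (phi (y x) * `|nu x|)%:E =
   \int[leb]_(x in `]a, b]) (phi (y x + k%:R) * `|nu x|)%:E)%E.
Proof.
elim: k a b phi => [|k IH] a b phi mphi phi0.
  by rewrite !addr0; apply: eq_integral => x _; rewrite addr0.
rewrite -natr1 !addrA integral_itvoc_shift; [|exact: mprod|]; last first.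
  by move=> x; rewrite lee_fin mulr_ge0.
have mphi1 : measurable_fun [set: R] (fun x => phi (x + 1)).
  by apply: (measurableT_comp mphi); exact: measurable_funD.
transitivity (\int[leb]_(x in `](a + k%:R)%R, (b + k%:R)%R])
    ((fun z => phi (z + 1)) (y x) * `|nu x|)%:E)%E.
  apply: ge0_ae_eq_integral => //.
  - apply: measurable_funTS; apply: (measurableT_comp (mprod mphi)).
    exact: measurable_funD.
  - exact: (measurable_funTS (mprod mphi1)).
  - by move=> x _; rewrite lee_fin mulr_ge0.
  - by move=> x _; rewrite lee_fin mulr_ge0.
  - apply: (@filterS _ _ (ae_filter_ringOfSetsType leb) _ _ _ nu1) => x nux _.
    by rewrite nux y1.
rewrite (IH _ _ (fun z => phi (z + 1)))//.
by apply: eq_integral => x _; rewrite addrA.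
Qed.

Variables (phi : R -> R) (M : R).
Hypotheses (cphi : continuous phi) (phi0 : forall x, 0 <= phi x).
Hypothesis phiM : forall x, M < `|x| -> phi x = 0.

Let mphi : measurable_fun [set: R] phi. Proof. exact: continuous_measurable_fun. Qed.

Let mshift (k : R) : measurable_fun [set: R] (fun x => phi (x + k)).
Proof. by apply: (measurableT_comp mphi); exact: measurable_funD. Qed.

Let pos (k : R) x : (0 <= (phi (y x + k) * `|nu x|)%:E)%E.
Proof. by rewrite lee_fin mulr_ge0. Qed.

Let mshift_sum K : measurable_fun [set: R] (shift_sum phi K).
Proof.
apply: measurable_sum => k; apply: measurable_funD; exact: mshift.
Qed.

Let integral_shift_sum (K : nat) :
  (\int[leb]_(x in `](- K%:R)%R, K%:R]) (phi (y x) * `|nu x|)%:E =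
   \int[leb]_(x in `]0%R, 1%R]) (shift_sum phi K (y x) * `|nu x|)%:E)%E.
Proof.
have m0 := mprod mphi.
have p0 x : (0 <= (phi (y x) * `|nu x|)%:E)%E by rewrite lee_fin mulr_ge0.
elim: K => [|K IH].
  rewrite oppr0 set_itvoc0 integral_set0.
  under eq_integral do rewrite /shift_sum big_ord0 mul0r.
  by rewrite integral0.
have K0 : 0 <= K%:R :> R by [].
rewrite (@ge0_integral_itvoc_setU _ _ _ (- K%:R))//; last 2 first.
- by rewrite -natr1; lra.
- by rewrite -natr1; lra.
rewrite (@ge0_integral_itvoc_setU _ _ (- K%:R) K%:R)//; last 2 first.
- by lra.
- by rewrite -natr1; lra.
rewrite IH.
have -> : (\int[leb]_(x in `]K%:R, K.+1%:R]) (phi (y x) * `|nu x|)%:E =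
    \int[leb]_(x in `]0%R, 1%R]) (phi (y x + K%:R) * `|nu x|)%:E)%E.
  by rewrite -(integral_shift _ _ _ mphi phi0) add0r addrC natr1.
have -> : (\int[leb]_(x in `](- K.+1%:R)%R, (- K%:R)%R]) (phi (y x) * `|nu x|)%:E =
    \int[leb]_(x in `]0%R, 1%R]) (phi (y x - K.+1%:R) * `|nu x|)%:E)%E.
  (* [integral_shift] moves cells to the right, so the left cell is reached by applying it to a
     shifted test function and reading the equality backwards. *)
  have := @integral_shift (fun z => phi (z - K.+1%:R)) K.+1 (- K.+1%:R) (- K%:R).
  move=> /(_ (mshift _) (fun _ => phi0 _)).
  have -> : - K%:R + K.+1%:R = 1 :> R by rewrite -natr1; lra.
  rewrite addNr.
  by move=> ->; apply: eq_integral => x _; rewrite addrK.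
have mm (k : R) :
    measurable_fun (`]0%R, 1%R]%classic : set (measurableTypeR R))
      (fun x => (phi (y x + k) * `|nu x|)%:E).
  exact: (measurable_funTS (mprod (mshift k))).
have ms : measurable_fun (`]0%R, 1%R]%classic : set (measurableTypeR R))
    (fun x => (shift_sum phi K (y x) * `|nu x|)%:E).
  exact: (measurable_funTS (mprod (mshift_sum K))).
have s0 x : 0 <= shift_sum phi K x by apply: sumr_ge0 => k _; rewrite addr_ge0.
have ps x : (0 <= (shift_sum phi K (y x) * `|nu x|)%:E)%E.
  by rewrite lee_fin mulr_ge0.
rewrite -ge0_integralD// -ge0_integralD//; last 2 first.
- by move=> x _; exact: adde_ge0.
- exact: emeasurable_funD.
apply: eq_integral => x _; rewrite -!EFinD; congr EFin.
rewrite /shift_sum big_ord_recr/=; lra.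
Qed.

Lemma integral_periodization :
  (\int[leb]_x ((phi (y x))%:E * `|nu x|%:E) =
   weighted_mass (periodization phi M \o y) nu)%E.
Proof.
have [B B0 yB] : exists2 B, 0 <= B & forall x, `|y x - x| <= B.
  apply: (@periodic_bounded _ (fun x => y x - x)).
    by move=> x; apply: cvgB; [exact: cy|exact: cvg_id].
  by move=> x; rewrite y1; lra.
(* This [K] serves twice: outside []-K, K]] the value [|y x|] exceeds [M], and for [x] in []0, 1]],
   where [|y x| <= B + 1], the truncated sum equals the periodization. *)
have [K KB] := exists_nat_ge (`|M| + B + 2).
have Mle := ler_norm M.
transitivity (\int[leb]_(x in `](- K%:R)%R, K%:R]) (phi (y x) * `|nu x|)%:E)%E.
  rewrite [RHS]integral_mkcond; apply: eq_integral => x _.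
  rewrite patchE; case: ifPn => //; rewrite mem_setE in_itv/= => xK.
  rewrite phiM ?mul0e// ltNge; apply: contra xK => yM.
  have := yB x; move: yM; rewrite !ler_norml => /andP[? ?] /andP[? ?].
  by apply/andP; split; lra.
rewrite integral_shift_sum; apply: eq_integral => x /=.
rewrite inE/= in_itv/= => /andP[x0 x1].
rewrite (@periodizationE _ _ _ phiM K)//.
suff : `|y x| <= B + 1 by lra.
rewrite -[y x](subrK x) (le_trans (ler_normD _ _))// lerD// ger0_norm; lra.
Qed.

End energy_over_a_period.

(** * Convergence *)

Section convergence.
Context {R : realType}.
Notation leb := (@lebesgue_measure R).

(** The two inequalities, written additively in the extended reals, also force [a n] to be
    eventually finite. *)
Lemma cvg_EFin_near (a : nat -> \bar R) (l : R) :
  (forall e : R, 0 < e -> \forall n \near \oo,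
    (a n <= (l + e)%:E)%E /\ (l%:E <= a n + e%:E)%E) -> a n @[n --> \oo] --> l%:E.
Proof.
move=> al; apply/fine_cvgP; split.
  apply: filterS (al 1 ltr01) => n [an la].
  by case: (a n) an la.
apply/cvgrPdist_le => e e0; apply: filterS (al e e0) => n [an la].
rewrite /comp; case: (a n) an la => //= r; rewrite -EFinD !lee_fin => ra la.
by rewrite ler_norml; apply/andP; split; lra.
Qed.

Lemma weighted_mass_le (psi1 psi2 nu : R -> R) (e : R) : 0 <= e ->
  measurable_fun [set: R] psi1 -> measurable_fun [set: R] psi2 ->
  measurable_fun [set: R] nu -> (forall x, 0 <= psi1 x) -> (forall x, 0 <= psi2 x) ->
  (forall x, psi1 x <= psi2 x + e) ->
  (weighted_mass psi1 nu <=
   weighted_mass psi2 nu + e%:E * weighted_mass (cst 1%R) nu)%E.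
Proof.
move=> e0 m1 m2 mnu p1 p2 le12.
have mn (psi : R -> R) : measurable_fun [set: R] psi ->
    measurable_fun [set: R] (fun x => (psi x * `|nu x|)%:E).
  move=> mpsi; apply/measurable_EFinP; apply: measurable_funM => //.
  exact: measurableT_comp.
have c1 := mn (cst (1 : R)) (measurable_cst _).
have n0 (psi : R -> R) x : (forall x, 0 <= psi x) -> (0 <= (psi x * `|nu x|)%:E)%E.
  by move=> psi0; rewrite lee_fin mulr_ge0.
rewrite /weighted_mass -ge0_integralZl_EFin//; last 2 first.
- by move=> x _; apply: n0 => z; exact: ler01.
- exact: (measurable_funTS c1).
rewrite -ge0_integralD//; last 4 first.
- by move=> x _; exact: n0.
- exact: (measurable_funTS (mn _ m2)).
- by move=> x _; rewrite mule_ge0 ?lee_fin// mul1r.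
- by apply: measurable_funeM; exact: (measurable_funTS c1).
apply: ge0_le_integral => //.
- by move=> x _; exact: n0.
- exact: (measurable_funTS (mn _ m1)).
- apply: emeasurable_funD; first exact: (measurable_funTS (mn _ m2)).
  by apply: measurable_funeM; exact: (measurable_funTS c1).
- move=> x _; rewrite -EFinM -EFinD lee_fin mul1r -mulrDl ler_wpM2r//.
Qed.

(** Since [ly X] and [k] are onto, every [x] is [ly X (k xi)]. Then [v x = lU X (k xi)] is close to
    [lU Y xi = u (ly Y xi)], and [ly Y xi] is within [dl] of [x]. *)
Lemma close_uniform (X Y : lagr R) (v u : R -> R) (dl e : R) :
  inF X -> close X Y dl ->
  (forall xi, lU X xi = v (ly X xi)) -> (forall xi, lU Y xi = u (ly Y xi)) ->
  (forall x z, `|x - z| <= dl -> `|u x - u z| <= e) ->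
  forall x, `|v x - u x| <= dl + e.
Proof.
move=> FX [k [[_ _ ks] [yk Uk _]]] UX UY ue x.
have [[_ [[cy _] y1] _ _] _] := FX.
have [eta <-] := quasiperiodic_surjective cy y1 x; have [xi <-] := ks eta.
rewrite -UX -(subrKA (lU Y xi)) (le_trans (ler_normD _ _))// lerD// UY.
by rewrite distrC; apply: ue; exact: yk.
Qed.

(** Two errors occur: [C * dl] from transporting the energy by [k], and [e] times the mass of [Y]
    from replacing the weight [Phi \o ly X \o k] by [Phi \o ly Y]. Only the mass of [Y], later the
    fixed limit, enters the bound. *)
Lemma close_weighted_mass (X Y : lagr R) (dl C e : R) (Phi : R -> R) :
  inF X -> inF Y -> close X Y dl -> 0 <= e -> continuous Phi ->
  (forall x, 0 <= Phi x <= C) -> (forall x, Phi (x + 1) = Phi x) ->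
  (forall x z, `|x - z| <= dl -> `|Phi x - Phi z| <= e) ->
  let bound := (e%:E * weighted_mass (cst 1%R) (lnu Y) + (C * dl)%:E)%E in
  (weighted_mass (Phi \o ly X) (lnu X) <=
     weighted_mass (Phi \o ly Y) (lnu Y) + bound)%E /\
  (weighted_mass (Phi \o ly Y) (lnu Y) <=
     weighted_mass (Phi \o ly X) (lnu X) + bound)%E.
Proof.
move=> FX FY [k [[mk k1 _] [yk _ nk]]] e0 cPhi PhiC Phi1 Phie bound.
have [[_ [[cyX _] yX1] _ _] _] := FX.
have [[[_ _ [[mnuY _ _] _]] [[cyY _] _] _ _] _] := FY.
have mPhi : measurable_fun [set: R] Phi by exact: continuous_measurable_fun.
have Phi0 x : 0 <= Phi x by have /andP[] := PhiC x.
have myX : measurable_fun [set: R] (ly X) by exact: continuous_measurable_fun.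
have myY : measurable_fun [set: R] (ly Y) by exact: continuous_measurable_fun.
have mPX : measurable_fun [set: R] (Phi \o ly X) by exact: measurableT_comp.
have mPY : measurable_fun [set: R] (Phi \o ly Y) by exact: measurableT_comp.
have mPk : measurable_fun [set: R] ((Phi \o ly X) \o k) by exact: measurableT_comp.
have [||h1 h2] := nk (Phi \o ly X) C mPX.
- by move=> x; exact: PhiC.
- by move=> x /=; rewrite yX1 Phi1.
have dPhi x : `|Phi (ly X (k x)) - Phi (ly Y x)| <= e by exact: Phie.
have g1 : (weighted_mass ((Phi \o ly X) \o k) (lnu Y) <=
    weighted_mass (Phi \o ly Y) (lnu Y) + e%:E * weighted_mass (cst 1%R) (lnu Y))%E.
  apply: weighted_mass_le => // x; try exact: Phi0.
  by have := dPhi x; rewrite ler_norml /= => /andP[]; lra.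
have g2 : (weighted_mass (Phi \o ly Y) (lnu Y) <=
    weighted_mass ((Phi \o ly X) \o k) (lnu Y) +
    e%:E * weighted_mass (cst 1%R) (lnu Y))%E.
  apply: weighted_mass_le => // x; try exact: Phi0.
  by have := dPhi x; rewrite ler_norml /= => /andP[]; lra.
split.
- by rewrite (le_trans h1)// /bound addeA leeD2r.
- rewrite (le_trans g2)// /bound [(_ * _ + _)%E]addeC addeA leeD2r//.
Qed.

Lemma cvg_energy (u_ : nat -> R -> R)
    (mu_ : nat -> {measure set (measurableTypeR R) -> \bar R})
    (u : R -> R) (mu : {measure set (measurableTypeR R) -> \bar R})
    (phi : R -> R) :
  (forall n, radon (mu_ n)) -> radon mu ->
  (dD (u_ n) (mu_ n) u mu @[n --> \oo] --> 0%E) ->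
  continuous phi -> compactly_supported phi -> (forall x, 0 <= phi x) ->
  (\int[mu]_x (phi x)%:E)%E \is a fin_num /\
  ((\int[mu_ n]_x (phi x)%:E)%E @[n --> \oo] --> (\int[mu]_x (phi x)%:E)%E).
Proof.
move=> r_ r hd cphi /compactly_supported_bound[M _ phiM] phi0.
have near_d e : 0 < e -> \forall n \near \oo, (dD (u_ n) (mu_ n) u mu < e%:E)%E.
  move=> e0; have /fine_cvgP[dfin /cvgrPdist_lt/(_ _ e0) dlt] := hd.
  apply: filterS2 dfin dlt => n dn; rewrite sub0r normrN /= => dne.
  by rewrite -(fineK dn) lte_fin (le_lt_trans (ler_norm _)).
pose Phi := periodization phi M.
have cPhi : continuous Phi by exact: continuous_periodization.
have mPhi : measurable_fun [set: R] Phi by exact: continuous_measurable_fun.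
have Phi0 x : 0 <= Phi x by exact: periodization_ge0.
have Phi1 x : Phi (x + 1) = Phi x by exact: periodization_periodic.
have [C C0 PhiC] := periodic_bounded cPhi Phi1.
have mphi : measurable_fun [set: R] (EFin \o phi).
  by apply/measurable_EFinP; exact: continuous_measurable_fun.
have energy (v : R -> R) (m : {measure set (measurableTypeR R) -> \bar R}) :
    radon m -> inF (Lmap v m) -> (\int[m]_x (phi x)%:E =
    weighted_mass (Phi \o ly (Lmap v m)) (lnu (Lmap v m)))%E.
  move=> rm [[[_ _ [[mnu _ _] nu1]] [[cy _] y1] _ _] _].
  rewrite -(energy_Lmap rm v mphi); last by move=> x; rewrite lee_fin.
  exact: integral_periodization.
set X := Lmap u mu.
(* A single term at distance less than 1 shows that the image of the limit pair lies in F. *)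
have [N0 _ /(_ N0 (leqnn _)) dN0] := near_d 1 ltr01.
have [_ FX _] := close_of_d dN0.
have [[[_ _ [lnuX nuX1]] [[cy _] y1] _ _] _] := FX.
have [mnuX _ _] := lnuX.
have my : measurable_fun [set: R] (ly X) by exact: continuous_measurable_fun.
pose H := weighted_mass (cst 1) (lnu X).
have H0 : (0 <= H)%E by apply: integral_ge0 => x _; rewrite lee_fin mul1r.
have Hfin : H \is a fin_num.
  have inu : leb.-integrable `]0%R, 1%R] (EFin \o lnu X).
    exact: locally_integrable_itv.
  rewrite ge0_fin_numE//; have /integrableP[_] := inu; congr (_ < _)%E.
  by apply: eq_integral => x _ /=; rewrite mul1r.
have mPy : measurable_fun [set: R] (Phi \o ly X) by exact: measurableT_comp.
have mufin : (\int[mu]_x (phi x)%:E)%E \is a fin_num.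
  rewrite (energy _ _ r FX) ge0_fin_numE; last first.
    by apply: integral_ge0 => x _; rewrite lee_fin; exact: (mulr_ge0 (Phi0 _)).
  (* Comparison of [Phi] with the zero weight, at uniform distance at most [C]. *)
  apply: (@le_lt_trans _ _ (weighted_mass (cst 0%R) (lnu X) + C%:E * H)%E).
    apply: weighted_mass_le => //; first by move=> x; exact: Phi0.
    by move=> x; rewrite /= add0r (le_trans (ler_norm _)).
  rewrite /weighted_mass; under eq_integral do rewrite mul0r.
  by rewrite integral0 add0e ltey_eq fin_numM.
split => //; rewrite -(fineK mufin); apply: cvg_EFin_near => e e0.
set l := fine _.
have lE : (l%:E = weighted_mass (Phi \o ly X) (lnu X))%E by rewrite fineK// (energy u).
have h0 : 0 <= fine H by rewrite fine_ge0.
(* [e1] is chosen for [e1 * H <= e / 2], and [dl] below for [C * dl <= e / 2]; the added 1 keeps the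
   denominators positive. *)
pose e1 := e / (2 * (fine H + 1)).
have e10 : 0 < e1 by rewrite divr_gt0// mulr_gt0//; lra.
have [d1 d10 Phid1] := periodic_uniformly_continuous cPhi Phi1 e10.
pose dl := Num.min d1 (e / (2 * (C + 1))).
have dl0 : 0 < dl by rewrite lt_min d10 divr_gt0// mulr_gt0//; lra.
have e1H : e1 * fine H <= e / 2.
  have -> : e / 2 = e1 * (fine H + 1) by rewrite /e1; field; rewrite gt_eqF//; lra.
  by rewrite ler_wpM2l ?(ltW e10)//; lra.
have Cdl : C * dl <= e / 2.
  have dle : dl <= e / (2 * (C + 1)) by rewrite ge_min lexx orbT.
  rewrite (le_trans (ler_wpM2l C0 dle))//.
  have -> : e / 2 = (C + 1) * (e / (2 * (C + 1))).
    by field; rewrite gt_eqF//; lra.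
  by rewrite ler_wpM2r ?divr_ge0 ?(ltW e0) ?mulr_ge0//; lra.
apply: filterS (near_d _ dl0) => n dn.
have [Fn _ Xnclose] := close_of_d dn.
rewrite (energy _ _ (r_ n) Fn) lE.
have PhiC' x : 0 <= Phi x <= C by rewrite Phi0 (le_trans (ler_norm _)).
have Phidl x z : `|x - z| <= dl -> `|Phi x - Phi z| <= e1.
  by move=> xz; apply: Phid1; rewrite (le_trans xz)// ge_min lexx.
have [h1 h2] := close_weighted_mass Fn FX Xnclose (ltW e10) cPhi PhiC' Phi1 Phidl.
have bound : (e1%:E * H + (C * dl)%:E <= e%:E)%E.
  by rewrite -(fineK Hfin) -EFinM -EFinD lee_fin; lra.
split.
- by rewrite EFinD lE (le_trans h1)// leeD2l.
- by rewrite (le_trans h2)// leeD2l.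
Qed.

End convergence.

Theorem proposition6p2 (R : realType)
    (u_ : nat -> R -> R)
    (mu_ : nat -> {measure set (measurableTypeR R) -> \bar R})
    (u : R -> R) (mu : {measure set (measurableTypeR R) -> \bar R})
    (hD_ : forall n : nat, inD (u_ n) (mu_ n)) (hD : inD u mu)
    (hcvg : dD (u_ n) (mu_ n) u mu @[n --> \oo] --> 0%E) :
  ('N[@lebesgue_measure R]_+oo [EFin \o (u_ n \- u)%R])%E
    @[n --> \oo] --> 0%E
  /\ weak_star_cvg mu_ mu.
Proof.
have r_ n : radon (mu_ n) by have [] := hD_ n.
have [[[cu _] u1 _ _] r _ _] := hD.
split.
  apply: cvg_EFin_near => e e0.
  have e2 : 0 < e / 2 by lra.
  have [d1 d10 ud] := periodic_uniformly_continuous cu u1 e2.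
  (* Half of [e] bounds the change of [U] between matched labels, the other half the change of [u]
     between the two positions. *)
  pose dl := Num.min d1 (e / 2).
  have dl0 : 0 < dl by rewrite lt_min d10.
  have /fine_cvgP[dfin /cvgrPdist_lt/(_ _ dl0) dlt] := hcvg.
  apply: filterS2 dfin dlt => n dn; rewrite sub0r normrN /= => dne.
  have {}dne : (dD (u_ n) (mu_ n) u mu < dl%:E)%E.
    by rewrite -(fineK dn) lte_fin (le_lt_trans (ler_norm _)).
  have [Fn _ Xnclose] := close_of_d dne.
  have ule x : `|u_ n x - u x| <= e.
    have dl1 : dl <= d1 by rewrite ge_min lexx.
    have dl2 : dl <= e / 2 by rewrite ge_min lexx orbT.
    have udl z z' (zz' : `|z - z'| <= dl) := ud z z' (le_trans zz' dl1).
    (* For [Lmap], [lU] is [u] composed with [ly] by computation: relabeling and translation act on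
       both by composition. *)
    have := close_uniform Fn Xnclose (fun=> erefl) (fun=> erefl) udl x.
    by move/le_trans; apply; lra.
  split; last by apply: adde_ge0; [exact: Lnorm_ge0|rewrite lee_fin ltW].
  rewrite add0r unlock; case: ifP => _; last by rewrite lee_fin ltW.
  by apply/ess_supP/aeW => x; rewrite /= lee_fin.
(* The positive parts of [phi] and of [- phi] are admissible in [cvg_energy]; both limits are
   finite, so the two convergences can be subtracted. *)
move=> phi cphi sphi.
have supp (f : R -> R) : (forall x, phi x = 0 -> f x = 0) -> compactly_supported f.
  move=> f0; apply: (subclosed_compact (@closed_closure _ _) sphi).
  by apply: closureS => x /=; apply: contra_neq; exact: f0.
have cmax (f : R -> R) : continuous f -> continuous (fun x => Num.max (f x) 0).
  move=> cf x.
  by apply: (@continuous_max R R f (cst 0)); [exact: cf|exact: cvg_cst].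
have part (f : R -> R) : continuous f -> (forall x, phi x = 0 -> f x = 0) ->
    (\int[mu]_x (Num.max (f x) 0)%:E)%E \is a fin_num /\
    ((\int[mu_ n]_x (Num.max (f x) 0)%:E)%E @[n --> \oo] -->
      (\int[mu]_x (Num.max (f x) 0)%:E)%E).
  move=> cf f0; apply: (cvg_energy r_ r hcvg); first exact: cmax.
    by apply: supp => x /f0 ->; rewrite maxxx.
  by move=> x; rewrite le_max lexx orbT.
have [pfin pcvg] := part phi cphi (fun _ => id).
have cN : continuous (fun x => - phi x) by move=> x; apply: cvgN; exact: cphi.
have N0 x : phi x = 0 -> - phi x = 0 by move=> ->; rewrite oppr0.
have [nfin ncvg] := part (fun x => - phi x) cN N0.
have posneg (m : {measure set (measurableTypeR R) -> \bar R}) :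
    (\int[m]_x (phi x)%:E = \int[m]_x (Num.max (phi x) 0)%:E -
      \int[m]_x (Num.max (- phi x) 0)%:E)%E.
  rewrite integralE; congr (_ - _)%E; apply: eq_integral => x _.
    by rewrite funeposE /= EFin_max.
  by rewrite funenegE /= EFin_max.
rewrite posneg; under eq_fun do rewrite posneg.
by apply: cvgeB => //; rewrite fin_num_adde_defl// fin_numN.
Qed.
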